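(* Let $X,Y$ be Banach spaces. Suppose that $\operatorname{SE}(X)$ is dense in $X^*$ and that $Y$ has property quasi-$\beta$. Then, for every closed subspace $\mathcal{I}(X,Y)$ of $\mathcal{L}(X,Y)$ containing all rank one operators, $\operatorname{ASE}(X,Y)\cap\mathcal{I}(X,Y)$ is dense in $\mathcal{I}(X,Y)$. In particular, $\operatorname{ASE}(X,Y)$ is dense in $\mathcal{L}(X,Y)$ and $\operatorname{ASE}(X,Y)\cap\mathcal{K}(X,Y)$ is dense in $\mathcal{K}(X,Y)$.
   Context: $\mathbb{K}\in\{\mathbb{R},\mathbb{C}\}$, $\mathbb{T}=\{\lambda\in\mathbb{K}\colon|\lambda|=1\}$. $\mathcal{K}(X,Y)$ is the space of compact operators. $\operatorname{SE}(X)$ is the set of $x^*\in X^*$ strongly exposing $B_X$ (there is $x_0\in B_X$ with $\operatorname{Re}x^*(x_0)=\sup_{B_X}\operatorname{Re}x^*$ and every sequence in $B_X$ with $\operatorname{Re}x^*(x_n)\to\operatorname{Re}x^*(x_0)$ converges in norm to $x_0$). $\operatorname{ASE}(X,Y)$ is the set of $T\in\mathcal{L}(X,Y)$ for which there is $x_0\in B_X$ such that whenever $\{x_n\}\subset B_X$ and $\|Tx_n\|\to\|T\|$, there exist $\theta_n\in\mathbb{T}$ with $\theta_nx_n\to x_0$. $Y$ has property quasi-$\beta$ if there exist a set $A=\{y_\lambda^*\colon\lambda\in\Lambda\}\subset S_{Y^*}$, a map $\sigma\colon A\to S_Y$ and a function $\rho\colon A\to\mathbb{R}$ such that (i) $y^*_\lambda(\sigma(y^*_\lambda))=1$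 for all $\lambda$; (ii) $|z^*(\sigma(y^* ))|\le\rho(y^* )<1$ whenever $y^*,z^*\in A$, $y^*\ne z^*$; (iii) for every extreme point $e^*$ of $B_{Y^*}$ there exist $A_{e^*}\subset A$ and $t\in\mathbb{K}$ with $|t|=1$ such that $te^*$ belongs to the weak$^*$-closure of $A_{e^*}$ and $\sup\{\rho(y^* )\colon y^*\in A_{e^*}\}<1$. *)

(* Defs.v *)
From mathcomp Require Import all_boot all_order all_algebra.
From mathcomp Require Import all_classical all_reals all_analysis.
From mathcomp Require Export complex.
Export numFieldNormedType.Exports.

Set Implicit Arguments.
Unset Strict Implicit.
Unset Printing Implicit Defensive.
Import Order.TTheory GRing.Theory Num.Theory.
Local Open Scope ring_scope.
Local Open Scope classical_set_scope.

(* The parameter [re : K -> R] is the real part map of the scalar field K;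
   it is instantiated by [id] (K = R) and by [complex.Re] (K = R[i]). *)

Definition ball1 (K : numFieldType) (X : normedModType K) : set X :=
  [set x : X | `|x| <= 1].

Definition is_op (K : numFieldType) (X Y : normedModType K) (T : X -> Y) : Prop :=
  (forall (a : K) (x y : X), T (a *: x + y) = a *: T x + T y) /\ continuous T.

Definition opnorm (R : realType) (K : numFieldType) (re : K -> R)
  (X Y : normedModType K) (T : X -> Y) : R :=
  sup [set re `|T x| | x in @ball1 K X].

Definition SE (R : realType) (K : numFieldType) (re : K -> R)
  (X : normedModType K) (f : X -> K^o) : Prop :=
  is_op f /\
  exists x0 : X, @ball1 K X x0 /\
    (forall x, @ball1 K X x -> re (f x) <= re (f x0)) /\
    (forall u : nat -> X, (forall n, @ball1 K X (u n)) ->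
       (fun n => re (f (u n))) @ \oo --> re (f x0) ->
       u @ \oo --> x0).

Definition ASE (R : realType) (K : numFieldType) (re : K -> R)
  (X Y : normedModType K) (T : X -> Y) : Prop :=
  is_op T /\
  exists x0 : X, @ball1 K X x0 /\
    (forall u : nat -> X, (forall n, @ball1 K X (u n)) ->
       (fun n => re `|T (u n)|) @ \oo --> opnorm re T ->
       exists th : nat -> K, (forall n, `|th n| = 1) /\
         (fun n => th n *: u n) @ \oo --> x0).

Definition op_dense (R : realType) (K : numFieldType) (re : K -> R)
  (X Y : normedModType K) (D Q : set (X -> Y)) : Prop :=
  forall T, Q T -> forall e : R, 0 < e ->
    exists S, D S /\ Q S /\ opnorm re (fun x => T x - S x) < e.

Definition closed_op_subspace (R : realType) (K : numFieldType) (re : K -> R)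
  (X Y : normedModType K) (I : set (X -> Y)) : Prop :=
  (forall T, I T -> is_op T) /\
  I (fun _ => 0) /\
  (forall T S, I T -> I S -> I (fun x => T x + S x)) /\
  (forall (a : K) T, I T -> I (fun x => a *: T x)) /\
  (forall T, is_op T ->
     (forall e : R, 0 < e -> exists S, I S /\ opnorm re (fun x => T x - S x) < e) ->
     I T).

Definition contains_rank_one (K : numFieldType) (X Y : normedModType K)
  (I : set (X -> Y)) : Prop :=
  forall (f : X -> K^o) (y : Y), is_op f -> I (fun x => f x *: y).

Definition compact_op (K : numFieldType) (X Y : normedModType K) (T : X -> Y) : Prop :=
  is_op T /\ compact (closure (T @` @ball1 K X)).

Definition dual_extreme (R : realType) (K : numFieldType) (re : K -> R)
  (Y : normedModType K) (e : Y -> K^o) : Prop :=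
  is_op e /\ opnorm re e <= 1 /\
  forall (f g : Y -> K^o), is_op f -> is_op g -> opnorm re f <= 1 -> opnorm re g <= 1 ->
    forall l : K, 0 < l -> l < 1 ->
      e = (fun y => l *: f y + (1 - l) *: g y) -> f = g.

Definition weakstar_closure (R : realType) (K : numFieldType) (re : K -> R)
  (Y : normedModType K) (A : set (Y -> K^o)) (h : Y -> K^o) : Prop :=
  forall (s : seq Y) (e : R), 0 < e ->
    exists a, A a /\ forall y, y \in s -> re `|a y - h y| < e.

Definition quasi_beta (R : realType) (K : numFieldType) (re : K -> R)
  (Y : normedModType K) : Prop :=
  exists (A : set (Y -> K^o)) (sigma : (Y -> K^o) -> Y) (rho : (Y -> K^o) -> R),
    (forall ys, A ys -> is_op ys /\ opnorm re ys = 1) /\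
    (forall ys, A ys -> `|sigma ys| = 1) /\
    (forall ys, A ys -> ys (sigma ys) = 1) /\
    (forall ys zs, A ys -> A zs -> ys <> zs ->
       re `|zs (sigma ys)| <= rho ys /\ rho ys < 1) /\
    (forall es, dual_extreme re es ->
       exists Ae : set (Y -> K^o), Ae `<=` A /\
         exists t : K, `|t| = 1 /\
           weakstar_closure re Ae (fun y => t * es y) /\
           exists r : R, r < 1 /\ forall ys, Ae ys -> rho ys <= r).

Definition theorem3p1_claim (R : realType) (K : numFieldType) (re : K -> R) : Prop :=
  forall (X Y : completeNormedModType K),
    op_dense re (@SE R K re X) (@is_op K X K^o) ->
    quasi_beta re Y ->
    (forall I : set (X -> Y), closed_op_subspace re I -> contains_rank_one I ->
       op_dense re (@ASE R K re X Y) I) /\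
    op_dense re (@ASE R K re X Y) (@is_op K X Y) /\
    op_dense re (@ASE R K re X Y) (@compact_op K X Y).

(* Main.v *)
(* Let E be the extreme points of the dual ball of Y.  A Lindenstrauss-type
   iteration T_(n+1) = T_n + c_n (f_n o T_n) (x) W_n, where W_n is the sum of the
   vectors T_k x_k with k <= n and f_n almost attains the norm of T_n at x_n while
   being real and nonnegative on the previous sum, converges to some S in I near T
   with n |S| - |sum_(k < n) S x_k| bounded.  For such a sequence the affine function
   p |-> sum_k (|S| - Re p (S x_k)) is finite somewhere on the dual ball, hence
   minimal on a nonempty closed face, which contains some e in E; therefore
   Re e (S x_k) gets arbitrarily close to |S| (Johannesen's theorem: an adjoint
   attaining its norm attains it on E).
   By quasi-beta, e can be replaced by a in A with |a o S| close to |S| and rho(a)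
   bounded away from 1.  If f in SE(X) is close to (1 + eps) a o S, the operator
   F = S + (f - a o S) (x) sigma(a) has a o F = f, whereas b o F has norm less than
   |f| uniformly in the other b in A; as A is norming, F inherits strong exposition
   from f.
   Faces of the dual ball are handled through their support functionals, so that
   Krein-Milman reduces to Zorn's lemma on sublinear functionals: a minimal
   functional supporting a face is linear, and it is an extreme point. *)
Require Import Defs.
From mathcomp Require Import all_boot all_order all_algebra.
From mathcomp Require Import all_classical all_reals all_analysis.
From mathcomp Require Import complex.
From mathcomp Require Import ring lra.

Set Implicit Arguments.
Unset Strict Implicit.
Unset Printing Implicit Defensive.
Import Order.TTheory GRing.Theory Num.Theory.
Local Open Scope ring_scope.
Local Open Scope classical_set_scope.

(* [re] is the real part and [emb] the inclusion of the reals, so that R and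
   R[i] are treated at once.  Every real-linear functional on a K-space is the
   real part of a K-linear one (p for K = R, x |-> p x - i p (i x) for K = C). *)
Record real_part (R : realType) (K : numFieldType) (re : K -> R)
    (emb : R -> K) : Prop := RealPart {
  reD : forall x y, re (x + y) = re x + re y;
  re_embM : forall a z, re (emb a * z) = a * re z;
  emb1 : emb 1 = 1;
  embD : forall a b, emb (a + b) = emb a + emb b;
  embM : forall a b, emb (a * b) = emb a * emb b;
  emb_ge0 : forall a : R, 0 <= a -> 0 <= emb a;
  ge0_emb : forall z : K, 0 <= z -> z = emb (re z);
  re_ge0 : forall z : K, 0 <= z -> 0 <= re z;
  re_le_norm : forall z, re z <= re `|z|;
  real_functional_lift : forall (V : lmodType K) (p : V -> R),
    (forall x y, p (x + y) = p x + p y) ->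
    (forall a x, p (emb a *: x) = a * p x) ->
    exists f : V -> K, (forall a x y, f (a *: x + y) = a * f x + f y) /\
      forall x, re (f x) = p x;
  disc_totally_bounded : forall M e : R, 0 < e ->
    exists s : seq K, forall z, re `|z| <= M ->
      exists2 w, w \in s & re `|z - w| < e }.

(** * Calculus of [re] and [emb], and norms read as real numbers *)

Section Scalars.
Variables (R : realType) (K : numFieldType) (re : K -> R) (emb : R -> K).
Hypothesis hK : real_part re emb.

Local Notation nr x := (re `|x|).

Lemma re0 : re 0 = 0.
Proof.
have := reD hK 0 0; rewrite addr0 => /eqP.
by rewrite -subr_eq0 opprD addNKr oppr_eq0 => /eqP.
Qed.

Lemma reN x : re (- x) = - re x.
Proof. by apply/eqP; rewrite -addr_eq0 -(reD hK) addNr re0. Qed.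

Lemma reB x y : re (x - y) = re x - re y.
Proof. by rewrite (reD hK) reN. Qed.

(** It suffices to know [re 1 = 1]. As [1 = emb (re 1)], the number [re 1] is idempotent, and it is
    nonzero, since otherwise [1 = emb 0] while additivity forces [emb 0 = 0]. *)
Lemma re_emb a : re (emb a) = a.
Proof.
have re1 : re 1 = 1.
  have := re_ge0 hK (@ler01 K); have := re_embM hK (re 1) 1.
  rewrite -(ge0_emb hK ler01) mulr1 => h h0.
  have h1 : re 1 != 0.
    apply/eqP => h1; have := ge0_emb hK (@ler01 K); rewrite h1 => h2.
    have /eqP := embD hK 0 0; rewrite addr0 -h2 -subr_eq0 opprD addNKr oppr_eq0.
    by rewrite oner_eq0.
  by apply: (mulfI h1); rewrite mulr1 -h.
by have := re_embM hK a 1; rewrite re1 !mulr1.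
Qed.

Lemma emb0 : emb 0 = 0.
Proof. by rewrite [RHS](ge0_emb hK (lexx _)) re0. Qed.

Lemma embN a : emb (- a) = - emb a.
Proof. by apply/eqP; rewrite -addr_eq0 -(embD hK) addNr emb0. Qed.

Lemma emb_le a b : (emb a <= emb b) = (a <= b).
Proof.
rewrite -subr_ge0 -[RHS]subr_ge0 -embN -(embD hK).
by apply/idP/idP => [/(re_ge0 hK)|/(emb_ge0 hK)//]; rewrite re_emb.
Qed.

Lemma emb_lt a b : (emb a < emb b) = (a < b).
Proof.
rewrite !lt_neqAle emb_le; congr andb; congr negb; apply/eqP/eqP => [h|-> //].
by rewrite -(re_emb a) h re_emb.
Qed.

Section Norm.
Variable V : normedModType K.
Implicit Types (x y : V).

Lemma norm_emb x : `|x| = emb (nr x).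
Proof. exact: ge0_emb hK _ _. Qed.

Lemma nr_ge0 x : 0 <= nr x.
Proof. exact: re_ge0 hK _ _. Qed.

Lemma nr0 : nr (0 : V) = 0.
Proof. by rewrite normr0 re0. Qed.

Lemma nrN x : nr (- x) = nr x.
Proof. by rewrite normrN. Qed.

Lemma nr_eq0 x : nr x = 0 -> x = 0.
Proof. by move=> h; apply/eqP; rewrite -normr_eq0 norm_emb h emb0. Qed.

Lemma nrD x y : nr (x + y) <= nr x + nr y.
Proof. by rewrite -emb_le (embD hK) -!norm_emb ler_normD. Qed.

Lemma nrB x y : nr (x - y) <= nr x + nr y.
Proof. by rewrite (le_trans (nrD _ _))// nrN. Qed.

Lemma nrBC x y : nr (x - y) = nr (y - x).
Proof. by rewrite distrC. Qed.

Lemma nrZ a x : nr (a *: x) = nr a * nr x.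
Proof. by rewrite normrZ {1}[`|a|](ge0_emb hK)// (re_embM hK). Qed.

Lemma nr_emb a : nr (emb a) = `|a|.
Proof.
have [a0|a0] := leP 0 a; first by rewrite ger0_norm ?(emb_ge0 hK)// re_emb ger0_norm.
by rewrite -normrN -embN ger0_norm ?(emb_ge0 hK) ?oppr_ge0 1?ltW// re_emb ltr0_norm.
Qed.

Lemma norm_lt x a : (`|x| < emb a) = (nr x < a).
Proof. by rewrite norm_emb emb_lt re_emb. Qed.

Lemma ball1P x : @ball1 K V x <-> nr x <= 1.
Proof. by rewrite /ball1/= [leLHS]norm_emb -(emb1 hK) emb_le. Qed.

Lemma nr_cvgP (u : nat -> V) (l : V) :
  u @ \oo --> l <-> forall e : R, 0 < e ->
    exists N, forall n, (N <= n)%N -> nr (u n - l) < e.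
Proof.
split=> [h e e0|h].
  move/cvgrPdist_lt in h.
  have /h[N _ hN] : 0 < emb e by rewrite -emb0 emb_lt.
  by exists N => n /hN /=; rewrite norm_lt nrBC.
apply/cvgrPdist_lt => e e0; have ee := ge0_emb hK (ltW e0).
have /h[N hN] : 0 < re e by rewrite -emb_lt -ee emb0.
by exists N => // n /hN hn /=; rewrite ee norm_lt nrBC.
Qed.

End Norm.

Lemma nrM (a b : K) : nr (a * b) = nr a * nr b.
Proof. by rewrite normrM {1}[`|a|](ge0_emb hK)// (re_embM hK). Qed.

Lemma nr_unit (t : K) : `|t| = 1 -> nr t = 1.
Proof. by move=> ->; rewrite -(emb1 hK) re_emb. Qed.

Lemma re_le_nr (z : K) : re z <= nr z.
Proof. exact: (re_le_norm hK). Qed.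

Lemma rotate (z : K) : exists t : K, `|t| = 1 /\ t * z = emb (nr z).
Proof.
have [->|z0] := eqVneq z 0.
  by exists 1; rewrite normr1 normr0 re0 emb0 mulr0.
exists (`|z| / z); rewrite normf_div normr_id divff ?normr_eq0//; split => //.
by rewrite divfK// -(ge0_emb hK).
Qed.

(** * Bounded operators and the operator norm *)

Section Operators.
Variables V W : normedModType K.
Implicit Types (T : V -> W) (x y : V).

Lemma opZD T a x y : is_op T -> T (a *: x + y) = a *: T x + T y.
Proof. by case=> + _; apply. Qed.

Lemma op0 T : is_op T -> T 0 = 0.
Proof.
move=> h; have := opZD (-1) 0 0 h; rewrite scaler0 addr0 scaleN1r.
by rewrite addNr.
Qed.

Lemma opD T x y : is_op T -> T (x + y) = T x + T y.
Proof. by move=> h; have := opZD 1 x y h; rewrite !scale1r. Qed.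

Lemma opZ T a x : is_op T -> T (a *: x) = a *: T x.
Proof. by move=> h; have := opZD a x 0 h; rewrite !addr0 op0// addr0. Qed.

Lemma opN T x : is_op T -> T (- x) = - T x.
Proof. by move=> h; rewrite -scaleN1r opZ// scaleN1r. Qed.

Lemma bounded_is_op T (M : R) :
  (forall a x y, T (a *: x + y) = a *: T x + T y) ->
  (forall x, nr (T x) <= M * nr x) -> is_op T.
Proof.
move=> lT bT; split=> // x.
have TB y z : T (y - z) = T y - T z.
  by rewrite -[y - z]addrC -scaleN1r lT scaleN1r addrC.
apply/cvgrPdist_lt => e e0; have ee := ge0_emb hK (ltW e0).
have e0' : 0 < re e by rewrite -emb_lt -ee emb0.
have M0 : 0 < `|M| + 1 by rewrite ltr_wpDl.
have d0 : 0 < emb (re e / (`|M| + 1)) by rewrite -emb0 emb_lt divr_gt0.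
near=> y; rewrite ee norm_lt -TB.
have : `|x - y| < emb (re e / (`|M| + 1)).
  near: y; apply/nbhs_ballP; exists (emb (re e / (`|M| + 1))) => //= z.
  by rewrite -ball_normE.
rewrite norm_lt ltr_pdivlMr// => h.
apply: le_lt_trans h; apply: le_trans (bT _) _; rewrite mulrC.
by rewrite ler_wpM2l ?nr_ge0// (le_trans (ler_norm _))// lerDl.
Unshelve. all: by end_near. Qed.

Lemma is_op_bounded T : is_op T ->
  exists2 M : R, 0 <= M & forall x, nr (T x) <= M * nr x.
Proof.
move=> hT; have /cvgrPdist_lt := hT.2 0.
have e0 : (0 : K) < 1 by [].
move=> /(_ _ e0)/nbhs_ballP[d/= d0 hd].
have dd := ge0_emb hK (ltW d0).
have d0' : 0 < re d by rewrite -emb_lt -dd emb0.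
exists (2 / re d) => [|x]; first by rewrite divr_ge0// ltW.
have [/nr_eq0->|x0] := eqVneq (nr x) 0; first by rewrite op0// !nr0 mulr0.
have x0' : 0 < nr x by rewrite lt_neqAle eq_sym x0 nr_ge0.
pose c := re d / (2 * nr x).
have c0 : 0 < c by rewrite divr_gt0// mulr_gt0.
have : ball (0 : V) d (emb c *: x).
  rewrite -ball_normE/= sub0r normrN dd norm_lt nrZ nr_emb gtr0_norm//.
  by rewrite /c; rewrite invfM mulrA divfK//; lra.
move=> /hd /=; rewrite op0// sub0r normrN -(emb1 hK) norm_lt opZ// nrZ.
rewrite nr_emb gtr0_norm// => h; have {h} := ltW h.
rewrite -ler_pdivlMl// => /le_trans; apply.
by rewrite /c invf_div mulr1 mulrAC.
Qed.

Lemma opnorm_le T (M : R) : (forall x, nr x <= 1 -> nr (T x) <= M) ->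
  opnorm re T <= M.
Proof.
move=> h; apply: ge_sup.
  by exists (nr (T 0)), 0 => //; apply/ball1P; rewrite nr0.
by move=> _ [x /ball1P x1 <-]; exact: h.
Qed.

Lemma opnorm_has_sup T : is_op T ->
  has_sup [set re `|T x| | x in @ball1 K V].
Proof.
move=> hT; split.
  by exists (nr (T 0)), 0 => //; apply/ball1P; rewrite nr0.
have [M M0 hM] := is_op_bounded hT; exists M => _ [x /ball1P x1 <-].
by apply: le_trans (hM x) _; rewrite ler_piMr.
Qed.

Lemma opnorm_ball T x : is_op T -> nr x <= 1 -> nr (T x) <= opnorm re T.
Proof.
move=> hT x1; apply: ub_le_sup; first by case: (opnorm_has_sup hT).
by exists x => //; apply/ball1P.
Qed.

Lemma opnorm_ge0 T : is_op T -> 0 <= opnorm re T.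
Proof.
move=> hT; apply: le_trans (opnorm_ball (x := 0) hT _); first exact: nr_ge0.
by rewrite nr0.
Qed.

Lemma opnorm_ub T x : is_op T -> nr (T x) <= opnorm re T * nr x.
Proof.
move=> hT; have [/nr_eq0->|x0] := eqVneq (nr x) 0.
  by rewrite op0// !nr0 mulr0.
have x0' : 0 < nr x by rewrite lt_neqAle eq_sym x0 nr_ge0.
have := @opnorm_ball T (emb (nr x)^-1 *: x) hT.
rewrite opZ// !nrZ nr_emb ger0_norm ?invr_ge0 ?nr_ge0// mulVf// => /(_ (lexx _)).
by rewrite ler_pdivrMl// mulrC.
Qed.

Lemma opnorm_approx T (e : R) : is_op T -> 0 < e ->
  exists2 x, nr x <= 1 & opnorm re T - e < nr (T x).
Proof.
move=> hT e0; have [_ [x /ball1P x1 <-] hx] :=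
  sup_adherent e0 (opnorm_has_sup hT).
by exists x.
Qed.

Lemma opnorm_le_bound T (M : R) : 0 <= M -> (forall x, nr (T x) <= M * nr x) ->
  opnorm re T <= M.
Proof.
by move=> M0 h; apply: opnorm_le => x x1; rewrite (le_trans (h x))// ler_piMr.
Qed.

Lemma is_op_add T S : is_op T -> is_op S -> is_op (fun x => T x + S x).
Proof.
move=> hT hS; apply: (@bounded_is_op _ (opnorm re T + opnorm re S)) => [a x y|x].
  by rewrite !opZD// scalerDr !addrA; congr (_ + _); rewrite addrAC.
rewrite mulrDl (le_trans (nrD _ _))//.
by apply: lerD; exact: opnorm_ub.
Qed.

Lemma is_op_scale a T : is_op T -> is_op (fun x => a *: T x).
Proof.
move=> hT; apply: (@bounded_is_op _ (nr a * opnorm re T)) => [b x y|x].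
  by rewrite opZD// scalerDr !scalerA [a * b]mulrC.
by rewrite nrZ -mulrA ler_wpM2l ?opnorm_ub// (re_ge0 hK).
Qed.

Lemma is_op0 : is_op (fun _ : V => 0 : W).
Proof.
apply: (@bounded_is_op _ 0) => [a x y|x]; last by rewrite nr0 mul0r.
by rewrite scaler0 addr0.
Qed.

Lemma is_op_sub T S : is_op T -> is_op S -> is_op (fun x => T x - S x).
Proof.
move=> hT hS; have := is_op_add hT (is_op_scale (-1) hS).
by under eq_fun do rewrite scaleN1r.
Qed.

Lemma opnormB_le T S : is_op T -> is_op S ->
  opnorm re T <= opnorm re S + opnorm re (fun x => T x - S x).
Proof.
move=> hT hS; apply: opnorm_le => x x1.
rewrite -(subrK (S x) (T x)) addrC (le_trans (nrD _ _))// lerD ?opnorm_ball//.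
exact: is_op_sub.
Qed.

Lemma opnormBC T S : opnorm re (fun x => T x - S x) = opnorm re (fun x => S x - T x).
Proof.
rewrite /opnorm; congr sup; apply/seteqP.
by split=> _ [x hx <-]; exists x => //; rewrite nrBC.
Qed.

End Operators.

Lemma is_op_comp (U V W : normedModType K) (S : V -> W) (T : U -> V) :
  is_op S -> is_op T -> is_op (fun x => S (T x)).
Proof.
move=> hS hT; apply: (@bounded_is_op _ _ _ (opnorm re S * opnorm re T)) => [a x y|x].
  by rewrite !opZD.
rewrite -mulrA (le_trans (opnorm_ub _ hS))//.
by rewrite ler_wpM2l ?opnorm_ub ?opnorm_ge0.
Qed.

Lemma is_op_rank_one (V W : normedModType K) (f : V -> K^o) (w : W) :
  is_op f -> is_op (fun x => f x *: w).
Proof.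
move=> hf; apply: (@bounded_is_op _ _ _ (opnorm re f * nr w)) => [a x y|x].
  by rewrite (opZD a x y hf) scalerDl -scalerA.
by rewrite nrZ mulrAC ler_wpM2r ?nr_ge0// opnorm_ub.
Qed.

(** * Sublinear support functionals and extreme points of the dual ball *)

Section ExtremeFunctionals.
Variable V : normedModType K.
Implicit Types (x y z : V) (p q : V -> R).

Definition sublinear q := (forall x y, q (x + y) <= q x + q y) /\
  (forall (a : R) x, 0 < a -> q (emb a *: x) = a * q x).

Definition real_dual_ball p := [/\ forall x y, p (x + y) = p x + p y,
  forall a x, p (emb a *: x) = a * p x & forall x, p x <= nr x].

(* [q] dominates exactly the functionals of a face of the dual ball. *)
Definition supports_face q := forall p1 p2 (l : R), real_dual_ball p1 ->
  real_dual_ball p2 -> 0 < l < 1 ->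
  (forall x, l * p1 x + (1 - l) * p2 x <= q x) -> forall x, p1 x <= q x.

Definition face_gauge q :=
  [/\ sublinear q, forall x, q x <= nr x & supports_face q].

(** The members [g j] need not be sublinear: it is enough that each bound required of the infimum is
    met by some further member of the family. The minorant [L] keeps the infimum finite. This serves
    tangent gauges, chains of gauges and the gauge of an almost aligned sequence. *)
Lemma inf_sublinear (J : Type) (D : set J) (g : J -> V -> R) (L : V -> R) :
  D !=set0 -> (forall j z, D j -> L z <= g j z) ->
  (forall i j y z, D i -> D j -> exists2 k, D k & g k (y + z) <= g i y + g j z) ->
  (forall i (a : R) z, D i -> 0 < a ->
    exists2 k, D k & g k (emb a *: z) <= a * g i z) ->
  let q := fun z => inf [set g j z | j in D] in
  [/\ sublinear q, forall j z, D j -> q z <= g j z & forall z, L z <= q z].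
Proof.
move=> D0 lbL gD gZ q.
have hinf z : has_inf [set g j z | j in D].
  split; first by have [j Dj] := D0; exists (g j z), j.
  by exists (L z) => _ [j Dj <-]; exact: lbL.
have qle j z : D j -> q z <= g j z.
  by move=> Dj; apply: ge_inf; [case: (hinf z) | exists j].
have leq z M : (forall j, D j -> M <= g j z) -> M <= q z.
  move=> h; apply: lb_le_inf; first by case: (hinf z).
  by move=> _ [j Dj <-]; exact: h.
have qZ (a : R) z : 0 < a -> q (emb a *: z) <= a * q z.
  move=> a0; rewrite -ler_pdivrMl//; apply: (leq _ _) => j Dj.
  have [k Dk hk] := gZ j a z Dj a0.
  by rewrite ler_pdivrMl// (le_trans _ hk)// qle.
split=> // [|z]; last by apply: (leq _ _) => j Dj; exact: lbL.
split=> [y z|a z a0].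
  rewrite -lerBlDr; apply: (leq _ _) => i Di; rewrite lerBlDr -lerBlDl.
  apply: (leq _ _) => j Dj; rewrite lerBlDl.
  by have [k Dk hk] := gD i j y z Di Dj; rewrite (le_trans _ hk)// qle.
apply/eqP; rewrite eq_le qZ//= -ler_pdivlMl//.
have zE : emb a^-1 *: (emb a *: z) = z.
  by rewrite scalerA -(embM hK) mulVf ?gt_eqF// (emb1 hK) scale1r.
by rewrite -{1}zE; apply: qZ; rewrite invr_gt0.
Qed.

Lemma sublinear0 q : sublinear q -> q 0 = 0.
Proof.
move=> [_ qZ]; have := qZ 2 0 (ltr0Sn _ _); rewrite scaler0.
by move=> h; lra.
Qed.

(* Support functional of the face of { p <= q } on which p y = q y. *)
Definition tangent_gauge q y z :=
  inf [set q (z + emb t *: y) - t * q y | t in [set t : R | 0 <= t]].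

(** A mixture below the tangent gauge is below [q], so both [p1] and [p2] are below [q]. The tangent
    gauge is at most [- q y] at [- y], so the mixture is at least [q y] at [y], which forces
    [p1 y = q y]. Then [p1 z = p1 (z + emb t *: y) - t * p1 y] lies below every term of the
    infimum. *)
Lemma tangent_gaugeP q y : face_gauge q ->
  face_gauge (tangent_gauge q y) /\
  forall (t : R) z, 0 <= t -> tangent_gauge q y z <= q (z + emb t *: y) - t * q y.
Proof.
move=> [[qD qZ] q1 qF]; have q0 := sublinear0 (conj qD qZ).
have qZ0 (t : R) x : 0 <= t -> q (emb t *: x) = t * q x.
  rewrite le_eqVlt => /orP[/eqP<-|]; last exact: qZ.
  by rewrite (emb0) scale0r mul0r.
have [| | | |h1 h2 h3] := @inf_sublinear R [set t : R | 0 <= t]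
    (fun t z => q (z + emb t *: y) - t * q y) (fun z => - q (- z)).
- by exists 0 => /=.
- move=> t z /= t0.
  by have := qD (z + emb t *: y) (- z); rewrite addrAC subrr add0r qZ0//; lra.
- move=> s t z1 z2 /= s0 t0; exists (s + t); first exact: addr_ge0.
  rewrite (embD hK) scalerDl addrACA.
  by have := qD (z1 + emb s *: y) (z2 + emb t *: y); lra.
- move=> t a z /= t0 a0; exists (a * t); first by rewrite mulr_ge0// ltW.
  by rewrite (embM hK) -scalerA -scalerDr qZ// mulrBr mulrA.
split=> //; have le0 z : tangent_gauge q y z <= q z.
  by have := h2 0 z (lexx _); rewrite /= emb0 scale0r addr0 mul0r subr0.
split=> // [x|p1 p2 l B1 B2 l01 hp]; first exact: le_trans (le0 x) (q1 x).
have [l0 l1] := andP l01.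
have hq x : l * p1 x + (1 - l) * p2 x <= q x := le_trans (hp x) (le0 x).
have p1q := qF _ _ _ B1 B2 l01 hq.
have p2q : forall x, p2 x <= q x.
  apply: (qF p2 p1 (1 - l)) => //; first by apply/andP; split; lra.
  by move=> x; have := hq x; lra.
have p1y : q y <= p1 y.
  have := hp (- y); have [D1 Z1 _] := B1; have [D2 Z2 _] := B2.
  have pN (p : V -> R) : (forall x z, p (x + z) = p x + p z) ->
      forall x, p (- x) = - p x.
    move=> pD x; have := pD 0 0; have := pD x (- x).
    by rewrite subrr addr0; lra.
  rewrite (pN p1)// (pN p2)// => h1'.
  have h2' : tangent_gauge q y (- y) <= - q y.
    have := h2 1 (- y) ler01.
    by rewrite /= (emb1 hK) scale1r addNr q0 mul1r sub0r.
  have h4 : l * p1 y + (1 - l) * p2 y >= q y by have := le_trans h1' h2'; lra.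
  have := p2q y; have : 0 < 1 - l by lra.
  move: h4 l0; clear; move=> h4 l0 l1 h5.
  rewrite -(ler_pM2l l0); have := ler_wpM2l (ltW l1) h5; lra.
move=> x; apply: lb_le_inf; first by exists (q (x + emb 0 *: y) - 0 * q y), 0 => /=.
move=> _ [t /= t0 <-]; have [D1 Z1 _] := B1.
have := p1q (x + emb t *: y); rewrite D1 Z1.
by have := ler_wpM2l t0 p1y; lra.
Qed.

(** Zorn's lemma for the reversed pointwise order. The pointwise infimum of a chain is finite
    because each gauge is at least minus the norm, and it still supports a face because
    [supports_face] can be tested on each member of the chain. *)
Lemma minimal_face_gauge q0 : face_gauge q0 ->
  exists q, [/\ face_gauge q, forall x, q x <= q0 x &
    forall q', face_gauge q' -> (forall x, q' x <= q x) -> q' = q].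
Proof.
move=> F0; pose T := {q : V -> R | face_gauge q /\ forall x, q x <= q0 x}.
pose r (s t : T) := `[< forall x, sval t x <= sval s x >].
have [| | |A totA|[q [Fq qq0]] qmin] := @Zorn T r.
- by move=> s; apply/asboolP.
- move=> s t u /asboolP st /asboolP tu; apply/asboolP => x.
  exact: le_trans (tu x) (st x).
- move=> [s Ps] [t Pt] /asboolP/= st /asboolP/= ts; apply: eq_exist.
  by apply/funext => x; apply/eqP; rewrite eq_le st ts.
(* The infimum over an empty chain carries no information, so [q0] itself is the bound there. *)
- have [[a0 Aa0]|A0] := pselect (A !=set0); last first.
    exists (exist _ q0 (conj F0 (fun x => lexx _))) => s As.
    by exfalso; apply: A0; exists s.
  have sN (s : T) z : - nr z <= sval s z.
    case: s => s [[sl s1 _] _] /=; have := sl.1 z (- z).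
    by rewrite subrr (sublinear0 sl); have := s1 (- z); rewrite nrN; lra.
  have [| | | |h1 h2 h3] := @inf_sublinear T A (fun s z => sval s z)
      (fun z => - nr z).
  + by exists a0.
  + by move=> s z _; exact: sN.
  + move=> s t y z As At; have [/asboolP st|/asboolP ts] := totA s t As At.
      exists t => //; have [[tl _] _] := (svalP t).1.
      by rewrite (le_trans (tl y z))// lerD2r.
    exists s => //; have [[sl _] _] := (svalP s).1.
    by rewrite (le_trans (sl y z))// lerD2l.
  + move=> s a z As a0'; exists s => //.
    by have [[_ sZ] _] := (svalP s).1; rewrite sZ.
  have Fi : face_gauge (fun z => inf [set sval s z | s in A]) /\
      forall z, inf [set sval s z | s in A] <= q0 z.
    split; last by move=> z; exact: le_trans (h2 _ z Aa0) ((svalP a0).2 z).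
    split=> // [z|p1 p2 l B1 B2 l01 hp z].
      by have [_ a1 _] := (svalP a0).1; exact: le_trans (h2 _ z Aa0) (a1 z).
    apply: lb_le_inf; first by exists (sval a0 z), a0.
    move=> _ [s As <-]; have [_ _ sF] := (svalP s).1.
    apply: (sF p1 p2 l) => // x; apply: le_trans (hp x) _; exact: h2.
  exists (exist (fun q => face_gauge q /\ forall x, q x <= q0 x) _ Fi) => s As.
  by apply/asboolP => x /=; exact: h2.
exists q; split=> // q' Fq' q'q.
have P' : face_gauge q' /\ forall x, q' x <= q0 x.
  by split=> // x; exact: le_trans (q'q x) (qq0 x).
have /qmin[] : r (exist _ q (conj Fq qq0)) (exist _ q' P') by apply/asboolP.
by [].
Qed.

(** A minimal gauge [q] equals its tangent gauge at every [y]; taking [t = 1] and [z = - y] there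
    gives [q (- y) = - q y], and an odd sublinear functional is linear. A linear functional below
    the linear [q] equals [q], so the face that [q] supports is a single point, which is extreme. *)
Lemma face_gauge_extreme q0 : face_gauge q0 ->
  exists p, [/\ real_dual_ball p, forall x, p x <= q0 x &
    forall p1 p2 (l : R), real_dual_ball p1 -> real_dual_ball p2 -> 0 < l < 1 ->
      (forall x, p x = l * p1 x + (1 - l) * p2 x) -> p1 = p /\ p2 = p].
Proof.
move=> /minimal_face_gauge[q [Fq qq0 qmin]].
have [[qD qZ] q1 qF] := Fq; have q00 := sublinear0 (conj qD qZ).
have qN y : q (- y) = - q y.
  have [Ft ht] := tangent_gaugeP y Fq.
  have tq : tangent_gauge q y = q.
    apply: qmin => // x; have := ht 0 x (lexx _).
    by rewrite emb0 scale0r addr0 mul0r subr0.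
  have := ht 1 (- y) ler01; rewrite tq (emb1 hK) scale1r addNr q00 mul1r.
  by have := qD y (- y); rewrite subrr q00; lra.
have qA x y : q (x + y) = q x + q y.
  have := qD x y; have := qD (x + y) (- y); rewrite addrK qN; lra.
have qL a x : q (emb a *: x) = a * q x.
  have [a0|a0|<-] := ltgtP 0 a; first exact: qZ.
    have : 0 < - a by lra.
    by move=> /(qZ (- a) x); rewrite (embN) scaleNr qN mulNr => /oppr_inj.
  by rewrite emb0 scale0r mul0r.
have Bq : real_dual_ball q by [].
have uniq p : real_dual_ball p -> (forall x, p x <= q x) -> p = q.
  move=> [pD _ _] pq; apply/funext => x; have := pq x; have := pq (- x).
  have := pD x (- x); have := pD 0 0; rewrite addr0 subrr qN; lra.
exists q; split=> // p1 p2 l B1 B2 l01 h; split; apply: uniq => //.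
  by apply: (qF p1 p2 l) => // x; rewrite h.
apply: (qF p2 p1 (1 - l)) => // [|x]; last by rewrite h; lra.
by apply/andP; move/andP: l01 => [? ?]; split; lra.
Qed.

Lemma re_functional_determined (f g : V -> K^o) : is_op f -> is_op g ->
  (forall x, re (f x) = re (g x)) -> f = g.
Proof.
move=> hf hg fg; apply/funext => x; apply/eqP; rewrite -subr_eq0; apply/eqP.
apply: (@nr_eq0 K^o); have [t [_ ht]] := rotate (f x - g x).
rewrite -[LHS]re_emb -ht mulrBr reB.
have -> : t * f x = f (t *: x) by rewrite (opZ _ _ hf).
have -> : t * g x = g (t *: x) by rewrite (opZ _ _ hg).
by rewrite fg subrr.
Qed.

Lemma re_functional_bound (f : V -> K) :
  (forall a x y, f (a *: x + y) = a * f x + f y) ->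
  (forall x, re (f x) <= nr x) -> forall x, nr (f x) <= nr x.
Proof.
move=> fL f1 x; have [t [t1 ht]] := rotate (f x).
have f0 : f 0 = 0.
  have := fL 1 0 0; rewrite scaler0 addr0 mul1r => /eqP.
  by rewrite -subr_eq0 opprD addNKr oppr_eq0 => /eqP.
have fZ : f (t *: x) = t * f x by have := fL t x 0; rewrite !addr0 f0 addr0.
have := f1 (t *: x); rewrite fZ ht re_emb => /le_trans; apply.
by rewrite nrZ nr_unit// mul1r.
Qed.

Lemma real_dual_ball_re (f : V -> K^o) : is_op f -> opnorm re f <= 1 ->
  real_dual_ball (fun x => re (f x)).
Proof.
move=> hf f1; split=> [x y|a x|x]; first by rewrite (opD _ _ hf) (reD hK).
  by rewrite (opZ _ _ hf) -(re_embM hK).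
apply: le_trans (re_le_nr _) _; apply: le_trans (opnorm_ub x hf) _.
by rewrite ler_piMl ?nr_ge0.
Qed.

(** Extremality passes from real functionals to [K]-linear ones: rotating the argument turns a bound
    on the real part into a bound on the modulus, and a functional is determined by its real
    part. *)
Lemma face_gauge_dual_extreme q : face_gauge q ->
  exists2 e : V -> K^o, dual_extreme re e & forall x, re (e x) <= q x.
Proof.
move=> Fq; have [p [[pD pZ p1] pq pext]] := face_gauge_extreme Fq.
have [f [fL fp]] := real_functional_lift hK pD pZ.
have f1 x : nr (f x) <= nr x.
  by apply: re_functional_bound => // y; rewrite fp.
have opf : @is_op K V K^o f.
  by apply: (@bounded_is_op _ _ _ 1) => // x; rewrite mul1r.
exists f => [|x]; last by rewrite fp.
split=> //; split=> [|f1' f2 hf1 hf2 n1 n2 l l0 l1 fE].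
  by apply: opnorm_le_bound => // x; rewrite mul1r.
(* An element of [K] strictly between 0 and 1 is real, also for complex [K], so [re l] is a real
   mixing weight. *)
have lE := ge0_emb hK (ltW l0).
have l01 : 0 < re l < 1.
  by apply/andP; split; rewrite -emb_lt -lE ?emb0 ?(emb1 hK).
have [] := pext _ _ _ (real_dual_ball_re hf1 n1) (real_dual_ball_re hf2 n2) l01.
  move=> x; rewrite -fp fE (reD hK) -[in RHS](re_embM hK) -lE.
  congr (_ + _); rewrite -(re_embM hK); congr (re (_ * _)).
  by rewrite (embD hK) (emb1 hK) embN -lE.
move=> e1 e2; apply: re_functional_determined => // x.
by rewrite (congr1 (@^~ x) e1) (congr1 (@^~ x) e2).
Qed.

Lemma dual_extreme_exists : exists e : V -> K^o, dual_extreme re e.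
Proof.
have [|e he _] := @face_gauge_dual_extreme (fun x => nr x); last by exists e.
split=> //; last by move=> p1 p2 l [].
by split=> [x y|a x a0]; [exact: nrD|rewrite nrZ nr_emb gtr0_norm].
Qed.

(** * Extreme functionals that almost attain along an almost aligned sequence *)

Section AlmostAlignedSequence.
Variables (u : nat -> V) (C : R).
Hypothesis u1 : forall n, nr (u n) <= 1.
Let w n := \sum_(k < n) u k.
Hypothesis wC : forall n : nat, n%:R - nr (w n) <= C.

Let defect n : R := n%:R - nr (w n).
Let m := sup (range defect).

Let defect_le n : defect n <= m.
Proof.
apply: ub_le_sup; last by exists n.
by exists C => _ [k _ <-]; exact: wC.
Qed.

Let defect_lub M : (forall n, defect n <= M) -> m <= M.
Proof.
move=> h; apply: ge_sup; first by exists (defect 0), 0%N.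
by move=> _ [k _ <-].
Qed.

Let w_step n k : nr (w (n + k) - w n) <= k%:R.
Proof.
elim: k => [|k IH]; first by rewrite addn0 subrr nr0.
rewrite addnS /w big_ord_recr/= addrAC (le_trans (nrD _ _))//.
by rewrite -[k.+1]addn1 natrD lerD.
Qed.

(** With [j = (s, n)] and [s >= 0], this bounds [p z] for every [p] in the dual ball with
    [n - p (w n) <= m]: write [p z = p (z + emb s *: w n) - s * p (w n)] and estimate the first term
    by the norm. *)
Let g (j : R * nat) z := nr (z + emb j.1 *: w j.2) - j.1 * (j.2%:R - m).

Let g_mono (s : R) n k z : 0 <= s -> g (s, (n + k)%N) z <= g (s, n) z.
Proof.
move=> s0; rewrite /g/= natrD.
have := nrD (z + emb s *: w n) (emb s *: (w (n + k) - w n)).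
rewrite -addrA -scalerDr addrC -[w n + _]addrC subrK nrZ nr_emb ger0_norm//.
by rewrite addrC; have := ler_wpM2l s0 (w_step n k); lra.
Qed.

(* Support functional of the face { p : n - p (w n) <= m for all n } of the dual
   ball, on which the affine function sum_k (1 - p (u k)) attains its minimum m. *)
Let aligned_gauge z := inf [set g j z | j in [set j | 0 <= j.1]].

(** The numbers [n - p (w n)] are nondecreasing in [n] and at least [defect n]. If a mixture keeps
    them below [m], then at index [n + k] the [p2] part is at least [defect k]; letting this
    approach the supremum [m] leaves at most [l * m] for the [p1] part, so [p1] satisfies the same
    constraint. *)
Let aligned_gaugeP :
  face_gauge aligned_gauge /\ forall j z, 0 <= j.1 -> aligned_gauge z <= g j z.
Proof.
have lb j z : 0 <= j.1 -> - nr z <= g j z.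
  case: j => s n /= s0; rewrite /g/=.
  have := nrB (z + emb s *: w n) z; rewrite addrC addKr nrZ nr_emb ger0_norm//.
  by have := ler_wpM2l s0 (defect_le n); rewrite /defect; lra.
have [| | | |h1 h2 h3] := @inf_sublinear (R * nat)%type [set j | 0 <= j.1] g
    (fun z => - nr z).
- by exists (0, 0%N) => /=.
- exact: lb.
- move=> [s n] [t k] y z /= s0 t0; exists (s + t, (n + k)%N) => /=.
    exact: addr_ge0.
  have := g_mono n k y s0; have := g_mono k n z t0; rewrite [(k + n)%N]addnC.
  rewrite /g/= (embD hK) scalerDl.
  have := nrD (y + emb s *: w (n + k)) (z + emb t *: w (n + k)).
  by rewrite addrACA; lra.
- move=> [s n] a z /= s0 a0; exists (a * s, n) => /=.
    by rewrite mulr_ge0// ltW.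
  rewrite /g/= (embM hK) -scalerA -scalerDr nrZ nr_emb gtr0_norm//.
  by rewrite [leRHS]mulrBr mulrA.
split=> //; split=> // [z|p1 p2 l B1 B2 /andP[l0 l1] hp z].
  have := h2 (0, 0%N) z (lexx _).
  by rewrite /g/= emb0 scale0r addr0 mul0r subr0.
have [D1 Z1 N1] := B1; have [D2 Z2 N2] := B2.
have pN (p : V -> R) : (forall x z, p (x + z) = p x + p z) ->
    forall x, p (- x) = - p x.
  move=> pD x; have := pD 0 0; have := pD x (- x).
  by rewrite subrr addr0; lra.
have mix n : l * (n%:R - p1 (w n)) + (1 - l) * (n%:R - p2 (w n)) <= m.
  have := le_trans (hp (- w n)) (h2 (1, n) (- w n) (ler01)).
  rewrite /g/= (emb1 hK) scale1r addNr nr0 mul1r (pN p1)// (pN p2)//; lra.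
have p1w n : n%:R - p1 (w n) <= m.
  have l1' : 0 < 1 - l by lra.
  suff : m <= (m - l * (n%:R - p1 (w n))) / (1 - l).
    by rewrite ler_pdivlMr// => h; rewrite -(ler_pM2l l0); lra.
  apply: defect_lub => k; rewrite ler_pdivlMr//.
  have dk : defect k <= defect (n + k)%N.
    have := nrD (w (k + n) - w k) (w k); rewrite subrK.
    by rewrite [(n + k)%N]addnC /defect natrD; have := w_step k n; lra.
  have p1k : n%:R - p1 (w n) <= (n + k)%:R - p1 (w (n + k)%N).
    have := D1 (w (n + k) - w n) (w n); rewrite subrK => ->.
    by rewrite natrD; have := N1 (w (n + k) - w n); have := w_step n k; lra.
  have p2k : defect (n + k)%N <= (n + k)%:R - p2 (w (n + k)%N).
    by rewrite /defect lerD2l lerN2.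
  have := mix (n + k)%N; have := ler_wpM2l (ltW l0) p1k.
  have := ler_wpM2l (ltW l1') (le_trans dk p2k); lra.
apply: lb_le_inf; first by exists (g (0, 0%N) z), (0, 0%N) => /=.
move=> _ [[s n] /= s0 <-]; rewrite /g/=.
have := N1 (z + emb s *: w n); rewrite D1 Z1.
by have := ler_wpM2l s0 (p1w n); lra.
Qed.

Lemma aligned_extreme_functional :
  exists2 e : V -> K^o, dual_extreme re e &
    forall n, n%:R - re (e (w n)) <= C.
Proof.
have [Fq qg] := aligned_gaugeP.
have [e he eq] := face_gauge_dual_extreme Fq; exists e => // n.
(* At [- w n] the member [(1, n)] has vanishing norm term and equals [m - n]. *)
have := le_trans (eq (- w n)) (qg (1, n) (- w n) ler01).
rewrite /g/= (emb1 hK) scale1r addNr nr0 mul1r (opN _ he.1) reN.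
by have : m <= C := defect_lub wC; lra.
Qed.

End AlmostAlignedSequence.

(** The constant sequence [x] has defect zero, so the almost aligned case yields an extreme
    functional attaining the norm of [x] exactly; this stands for Hahn-Banach combined with
    Krein-Milman. *)
Lemma extreme_functional_norming x : nr x = 1 ->
  exists2 e : V -> K^o, dual_extreme re e & re (e x) = 1.
Proof.
move=> x1; have wE n : \sum_(k < n) x = emb n%:R *: x.
  rewrite big_const_ord; elim: n => [|n IH] /=; first by rewrite emb0 scale0r.
  by rewrite IH -[n.+1]addn1 natrD addrC (embD hK) (emb1 hK) scalerDl scale1r.
have [|n|e he eC] := @aligned_extreme_functional (fun=> x) 0.
- by move=> _; rewrite x1.
- by rewrite wE nrZ nr_emb x1 mulr1 ger0_norm ?subrr.
exists e => //; apply/eqP; rewrite eq_le.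
have [_ _ e1] := real_dual_ball_re he.1 he.2.1.
rewrite (le_trans (e1 x)) ?x1//=.
by have := eC 1%N; rewrite big_ord_recl big_ord0 addr0 subr_le0.
Qed.

End ExtremeFunctionals.

(** * Geometric estimates and limits of fast Cauchy sequences *)

Lemma le_geometric_le0 (r M : R) : (forall n, r <= M * 2^-1 ^+ n) -> r <= 0.
Proof.
move=> h; rewrite leNgt; apply/negP => r0.
pose n := Num.bound (`|M| / r).
have hn : `|M| / r < n%:R by rewrite archi_boundP// divr_ge0// ltW.
have : n%:R <= 2 ^+ n :> R by rewrite -natrX ler_nat ltnW// ltn_expl.
have := h n; rewrite exprVn ler_pdivlMr ?exprn_gt0//.
rewrite ltr_pdivrMr// in hn; have := ler_norm M => h1 h2 h3.
by have := ler_wpM2l (ltW r0) h3; lra.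
Qed.

Lemma geometric_small (M e : R) : 0 < e -> exists n, M * 2^-1 ^+ n < e.
Proof.
move=> e0; apply: contrapT => /forallNP h.
have := @le_geometric_le0 e M; rewrite leNgt e0 => /(_ _)/negP; apply=> // n.
by rewrite leNgt; apply/negP; exact: h.
Qed.

Lemma half_exp_gt0 n : 0 < 2^-1 ^+ n :> R.
Proof. by rewrite exprn_gt0// invr_gt0. Qed.

Lemma half_expS n : 2^-1 ^+ n.+1 = 2^-1 ^+ n / 2 :> R.
Proof. by rewrite exprSr. Qed.

Lemma fast_cauchy_cvg (V : completeNormedModType K) (v : nat -> V) (a : R) :
  (forall n, nr (v n.+1 - v n) <= a * 2^-1 ^+ n) ->
  exists l, forall n, nr (l - v n) <= 2 * a * 2^-1 ^+ n.
Proof.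
move=> va; have a0 : 0 <= a.
  by have := le_trans (nr_ge0 _) (va 0%N); rewrite expr0 mulr1.
(* Keeping the exact geometric remainder lets the induction on [k] close; the coarser bound
   follows. *)
have vk n k : nr (v (n + k)%N - v n) <= 2 * a * (2^-1 ^+ n - 2^-1 ^+ (n + k)).
  elim: k => [|k IH]; first by rewrite addn0 !subrr nr0 mulr0.
  rewrite addnS half_expS -(subrK (v (n + k)%N) (v _.+1)) -addrA.
  by apply: le_trans (nrD _ _) _; have := va (n + k)%N; lra.
have vk' n k : nr (v (n + k)%N - v n) <= 2 * a * 2^-1 ^+ n.
  apply: le_trans (vk n k) _; rewrite ler_wpM2l ?mulr_ge0//.
  by rewrite gerBl ltW// half_exp_gt0.
have : cauchy (v @ \oo).
  apply: cauchy_exP => e e0; have ee := ge0_emb hK (ltW e0).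
  have e0' : 0 < re e by rewrite -emb_lt -ee emb0.
  have [n hn] := geometric_small (2 * a) e0'.
  exists (v n), n => // k /= nk; rewrite -ball_normE/= ee norm_lt nrBC.
  by rewrite -(subnKC nk) (le_lt_trans _ hn).
move=> /cauchy_cvgP/cvg_ex[l /nr_cvgP hl]; exists l => n.
apply/ler_addgt0Pr => e e0; have [N hN] := hl _ e0.
rewrite -(subrK (v (n + N)%N) l) -addrA addrC (le_trans (nrD _ _))// lerD//.
by rewrite nrBC ltW// hN// leq_addl.
Qed.

(** * Perturbing an operator so that an extreme functional almost attains its norm *)

Section Perturbation.
Variables X Y : completeNormedModType K.
Implicit Types (T : X -> Y) (f : Y -> K^o).

(** Completeness of [Y] is applied at each point; the limit is linear because its linearity defect
    is bounded by a fixed multiple of [2^-1 ^+ n] for every [n]. *)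
Lemma fast_cauchy_op (T : nat -> X -> Y) (d : R) : (forall n, is_op (T n)) ->
  (forall n x, nr (T n.+1 x - T n x) <= d * 2^-1 ^+ n * nr x) ->
  exists2 S, is_op S & forall n x, nr (S x - T n x) <= 2 * d * 2^-1 ^+ n * nr x.
Proof.
move=> opT Td.
have /choice[S hS] : forall x, exists l,
    forall n, nr (l - T n x) <= 2 * d * 2^-1 ^+ n * nr x.
  move=> x; have [|l hl] := @fast_cauchy_cvg _ (fun n => T n x) (d * nr x).
    by move=> n; have := Td n x; rewrite mulrAC.
  by exists l => n; have := hl n; rewrite mulrA mulrAC.
exists S => //.
apply: (@bounded_is_op _ _ _ (opnorm re (T 0%N) + 2 * d)) => [a x y|x].
  apply/eqP; rewrite -subr_eq0; apply/eqP/nr_eq0/eqP.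
  rewrite eq_le nr_ge0 andbT.
  apply: (@le_geometric_le0 _ (2 * d * (nr (a *: x + y) + nr a * nr x + nr y))).
  move=> n; have -> : S (a *: x + y) - (a *: S x + S y) =
      (S (a *: x + y) - T n (a *: x + y)) - (a *: (S x - T n x) + (S y - T n y)).
    rewrite (opZD a x y (opT n)) scalerBr [in RHS]addrACA -opprD.
    by rewrite (opprB (a *: S x + S y)) subrKA.
  apply: le_trans (nrB _ _) _.
  apply: (@le_trans _ _ (2 * d * 2^-1 ^+ n * nr (a *: x + y) +
    (nr a * (2 * d * 2^-1 ^+ n * nr x) + 2 * d * 2^-1 ^+ n * nr y))).
    rewrite lerD// (le_trans (nrD _ _))// lerD// nrZ.
    by apply: ler_wpM2l; [exact: (re_ge0 hK)|exact: hS].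
  by rewrite le_eqVlt; apply/orP; left; apply/eqP; ring.
rewrite -(subrK (T 0%N x) (S x)) (le_trans (nrD _ _))// mulrDl addrC.
by apply: lerD; [exact: opnorm_ub|have := hS x 0%N; rewrite expr0 mulr1].
Qed.

(** Two rotations are free: one of the functional makes its value at [W] nonnegative, and one of [x]
    then makes its value at [T x] nonnegative without changing the former. *)
Lemma almost_norming_pair T (W : Y) (eta : R) : is_op T -> 0 < eta ->
  exists f x, [/\ is_op f, forall y, nr (f y) <= nr y, nr x <= 1,
    f W = emb (nr (f W)) &
    exists2 rho, opnorm re T - eta <= rho & f (T x) = emb rho].
Proof.
move=> opT eta0; have [x0 x01 hx0] := opnorm_approx opT eta0.
have [Tx0|Tx0] := eqVneq (nr (T x0)) 0.
  (* If [T x0] vanishes then [opnorm re T - eta] is negative, so the zero functional serves. *)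
  exists (fun=> 0), 0; split=> [|y| | |].
  - exact: is_op0.
  - by rewrite nr0 nr_ge0.
  - by rewrite nr0.
  - by rewrite nr0 emb0.
  - by exists 0; [rewrite ltW// -Tx0|rewrite emb0].
have Tx0' : 0 < nr (T x0) by rewrite lt_neqAle eq_sym Tx0 nr_ge0.
have [|e [ope [e1 _]] eT] :=
    @extreme_functional_norming Y (emb (nr (T x0))^-1 *: T x0).
  by rewrite nrZ nr_emb ger0_norm ?invr_ge0 ?nr_ge0// mulVf.
have {}e1 y : nr (e y) <= nr y.
  by apply: le_trans (opnorm_ub y ope) _; rewrite ler_piMl// nr_ge0.
rewrite (opZ _ _ ope) (re_embM hK) in eT.
have {}eT : re (e (T x0)) = nr (T x0).
  by rewrite -[LHS](mulVKf Tx0) eT mulr1.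
have [t [t1 tW]] := rotate (e W).
have [s [s1 sT]] := rotate (t * e (T x0)).
have ft y : nr (t * e y) = nr (e y) by rewrite nrM nr_unit// mul1r.
exists (fun y => t *: e y), (s *: x0); split.
- exact: is_op_scale.
- by move=> y; rewrite ft.
- by rewrite nrZ nr_unit// mul1r.
- by rewrite ft.
- exists (nr (t * e (T x0))).
    by rewrite ft (le_trans (ltW hx0))// -eT re_le_nr.
  by rewrite -sT (opZ _ _ opT) (opZ _ _ ope); exact: mulrCA.
Qed.

(* The perturbation raises the norm by about c B |T|; as f1 almost attains the new
   norm, |f1 W| cannot be much smaller than B = f W. *)
Lemma perturbation_step T T1 f x W f1 x1 (eta rho B c : R) :
  T1 = (fun z => T z + (emb c * f (T z)) *: W) ->
  is_op T -> is_op f -> (forall y, nr (f y) <= nr y) -> nr x <= 1 ->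
  f (T x) = emb rho -> opnorm re T - eta <= rho ->
  f W = emb B -> 0 <= B -> 0 <= c ->
  is_op f1 -> (forall y, nr (f1 y) <= nr y) -> nr x1 <= 1 ->
  is_op T1 ->
  (opnorm re T - eta) * (1 + c * B) <= opnorm re T1 /\
  re (f1 (T1 x1)) <= opnorm re T * (1 + c * nr (f1 W)).
Proof.
move=> T1E opT opf f1' x1' fT Trho fW B0 c0 opf1 f1'' x1'' opT1.
have cB : 0 <= 1 + c * B by rewrite addr_ge0// mulr_ge0.
split.
  apply: (@le_trans _ _ (rho * (1 + c * B))); first by rewrite ler_wpM2r.
  apply: le_trans (opnorm_ball opT1 x1'); apply: le_trans (f1' _).
  apply: le_trans (re_le_nr _); rewrite T1E (opD _ _ opf) (opZ _ _ opf) fT fW.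
  rewrite /GRing.scale/= -!(embM hK) -(embD hK) re_emb le_eqVlt.
  by apply/orP; left; apply/eqP; ring.
apply: le_trans (re_le_nr _) _; rewrite T1E (opD _ _ opf1) (opZ _ _ opf1).
apply: le_trans (nrD _ _) _; rewrite nrZ nrM nr_emb (ger0_norm c0).
have Tx1 := opnorm_ball opT x1''.
rewrite mulrDr mulr1; apply: lerD; first exact: le_trans (f1'' _) Tx1.
rewrite mulrA [_ * c]mulrC; apply: ler_wpM2r; first exact: (re_ge0 hK).
by apply: ler_wpM2l => //; exact: le_trans (f1' _) Tx1.
Qed.

Lemma closed_subspace_rank_one_perturbation (I : set (X -> Y)) T (g : X -> K^o) W :
  closed_op_subspace re I -> contains_rank_one I -> I T -> is_op g ->
  I (fun z => T z + g z *: W).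
Proof. by move=> [_ [_ [ID _]]] I1 IT opg; apply: ID => //; exact: I1. Qed.

(** The state is the pair [(T n, W n)]; each step feeds it with the tolerance [eta n] to one
    selector of [(f, x, rho)]. Membership in [I] is carried along, since each step adds a rank one
    operator. *)
Lemma perturbation_sequence (I : set (X -> Y)) T0 (c eta : nat -> R) :
  closed_op_subspace re I -> contains_rank_one I -> I T0 ->
  (forall n, 0 < eta n) ->
  exists (T : nat -> X -> Y) (W : nat -> Y) (f : nat -> Y -> K^o)
    (x : nat -> X) (rho : nat -> R),
  [/\ T 0%N = T0, W 0%N = 0, forall n, W n.+1 = W n + T n (x n),
    forall n, T n.+1 = fun z => T n z + (emb (c n) * f n (T n z)) *: W n.+1 &
    forall n, [/\ I (T n), is_op (f n), forall y, nr (f n y) <= nr y &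
      nr (x n) <= 1] /\
      [/\ f n (W n) = emb (nr (f n (W n))), opnorm re (T n) - eta n <= rho n &
        f n (T n (x n)) = emb (rho n)]].
Proof.
move=> hI I1 IT0 eta0.
pose spec (p : (X -> Y) * Y * R) (q : (Y -> K^o) * X * R) :=
  [/\ is_op q.1.1, forall y, nr (q.1.1 y) <= nr y & nr q.1.2 <= 1] /\
  [/\ q.1.1 p.1.2 = emb (nr (q.1.1 p.1.2)), opnorm re p.1.1 - p.2 <= q.2 &
    q.1.1 (p.1.1 q.1.2) = emb q.2].
have /choice[pick pickP] : forall p, exists q, is_op p.1.1 -> 0 < p.2 -> spec p q.
  move=> [[T W] e]; have [[opT e0]|h] := pselect (is_op T /\ 0 < e); last first.
    (* Outside the hypotheses the total selector returns zeros. *)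
    by exists (fun=> 0, 0, 0) => /= *; exfalso; exact: h.
  have [f [x [h1 h2 h3 h4 [rho h5 h6]]]] := almost_norming_pair W opT e0.
  by exists (f, x, rho).
pose st := fix st n : (X -> Y) * Y := if n is k.+1 then
  let: (f, x, _) := pick (st k, eta k) in
  (fun z => (st k).1 z + (emb (c k) * f ((st k).1 z)) *: ((st k).2 + (st k).1 x),
   (st k).2 + (st k).1 x) else (T0, 0).
pose q n := pick (st n, eta n).
have stS n : st n.+1 =
  (fun z => (st n).1 z + (emb (c n) * (q n).1.1 ((st n).1 z)) *:
     ((st n).2 + (st n).1 (q n).1.2), (st n).2 + (st n).1 (q n).1.2).
  by rewrite /q /=; case: (pick _) => [[f x] r].
have qP n : I (st n).1 -> spec (st n, eta n) (q n).
  by move=> In; apply: pickP; [exact: hI.1|exact: eta0].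
have Ist n : I (st n).1.
  elim: n => [//|n IH]; rewrite stS /=.
  have [[opf _ _] _] := qP n IH.
  apply: (closed_subspace_rank_one_perturbation
    (g := fun z => emb (c n) * (q n).1.1 ((st n).1 z))) => //.
  apply: (@is_op_scale _ K^o _ (fun z => (q n).1.1 ((st n).1 z))).
  by apply: is_op_comp => //; exact: hI.1.
exists (fun n => (st n).1), (fun n => (st n).2), (fun n => (q n).1.1),
  (fun n => (q n).1.2), (fun n => (q n).2).
split=> // [n|n|n]; [by rewrite stS|by rewrite stS|].
by have [[h1 h2 h3] [h4 h5 h6]] := qP n (Ist n).
Qed.

(** The two estimates of [t1] give [t0 * (c * (B - b)) <= eta * (1 + c * B) + eta1 <= 3 * eta];
    dividing by [t0 >= t / 2] and inserting the value of [eta] yields the factor 6. *)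
Lemma perturbation_gain (t t0 t1 h c B b eta eta1 : R) : 0 < t -> 0 < c ->
  t / 2 <= t0 -> 0 <= B -> c * B <= 1 -> 0 <= h ->
  eta = c * t ^+ 2 * h -> eta1 <= eta ->
  (t0 - eta) * (1 + c * B) <= t1 -> t1 - eta1 <= t0 * (1 + c * b) ->
  B - 6 * t * h <= b.
Proof.
move=> t_gt0 c_gt0 tt0 B0 cB h0 etaE eta1_le le1 le2.
rewrite leNgt; apply/negP => lt_b.
have eta0 : 0 <= eta by rewrite etaE !mulr_ge0 ?exprn_ge0// ltW.
have e1 : t0 * (c * (B - b)) <= 3 * eta.
  by have := ler_wpM2l eta0 cB; lra.
have lt_c : c * (6 * t * h) < c * (B - b) by rewrite ltr_pM2l//; lra.
have ch : 0 <= c * (6 * t * h) by rewrite !mulr_ge0// ltW.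
have t2 : 0 < t / 2 by lra.
have : t / 2 * (c * (6 * t * h)) < t0 * (c * (B - b)).
  apply: (@lt_le_trans _ _ (t / 2 * (c * (B - b)))); first by rewrite ltr_pM2l.
  by rewrite ler_wpM2r// ltW// (le_lt_trans ch).
by rewrite etaE in e1; nra.
Qed.

Lemma ge_geometric (a : nat -> R) (C : R) :
  (forall n, a n - C * 2^-1 ^+ n <= a n.+1) -> 0 <= C ->
  forall n, a 0%N - 2 * C <= a n.
Proof.
move=> h C0 n.
suff H : a 0%N - 2 * C * (1 - 2^-1 ^+ n) <= a n.
  have := half_exp_gt0 n => hn; have := mulr_ge0 C0 (ltW hn); lra.
elim: n => [|n IH]; first by rewrite expr0 subrr mulr0 subr0.
by have := h n; rewrite half_expS; lra.
Qed.

Lemma natr_half_exp n : n.+1%:R * 2^-1 ^+ n <= 1 :> R.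
Proof.
rewrite exprVn ler_pdivrMr ?exprn_gt0// mul1r -natrX ler_nat.
exact: ltn_expl.
Qed.

(** The value of [f n] on the running sum grows by almost the full operator norm at every step:
    [f n.+1] is almost as large as [f n] on the old sum, and the new vector contributes [rho n.+1].
    All losses are geometric, so the total defect stays bounded. *)
Lemma almost_aligned_perturbation (I : set (X -> Y)) T0 (eps : R) :
  closed_op_subspace re I -> contains_rank_one I -> I T0 ->
  0 < opnorm re T0 -> 0 < eps ->
  exists (S : X -> Y) (x : nat -> X), [/\ I S, opnorm re (fun z => T0 z - S z) <= eps,
    0 < opnorm re S, forall n, nr (x n) <= 1 &
    exists C : R, forall n : nat,
      n%:R * opnorm re S - nr (\sum_(k < n) S (x k)) <= C].
Proof.
move=> hI I1 IT0; set t := opnorm re T0 => t0 eps0.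
(* This makes [4 * d] below equal to the minimum of [t] and [eps], so the total displacement, at
   most [2 * d], is at most half of each. *)
pose kappa := Num.min t eps / (16 * t ^+ 2).
have m0 : 0 < Num.min t eps by rewrite lt_min t0.
have k0 : 0 < kappa by rewrite divr_gt0// mulr_gt0// exprn_gt0.
have kE : 16 * (kappa * t ^+ 2) = Num.min t eps.
  by rewrite mulrCA divfK// gt_eqF// mulr_gt0// exprn_gt0.
have kt0 : 0 < kappa * t ^+ 2 := mulr_gt0 k0 (exprn_gt0 2 t0).
clearbody kappa.
pose d := 4 * (kappa * t ^+ 2).
have d_t : 4 * d <= t by rewrite /d mulrA -natrM kE ge_min lexx.
have d_eps : 4 * d <= eps by rewrite /d mulrA -natrM kE ge_min lexx orbT.
have d0 : 0 < d by rewrite mulr_gt0.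
have kt : 16 * (kappa * t) <= 1.
  by rewrite -(ler_pM2r t0) mul1r -!mulrA -expr2 kE ge_min lexx.
pose h n : R := 2^-1 ^+ n.
have h0 n : 0 < h n := half_exp_gt0 n.
have hE n : h n.+1 = h n / 2 := half_expS n.
have hZ : h 0%N = 1 := expr0 _.
have h1 n : h n <= 1 by rewrite /h exprn_ile1// ?invr_ge0// invf_le1// ler1n.
have hS n : h n.+1 <= h n by rewrite hE; have := h0 n; lra.
have hn n : n.+1%:R * h n <= 1 := natr_half_exp n.
(* The perturbation at stage [n] has norm at most [c n * (2 * t) * (n.+1%:R * (2 * t))]: one factor
   [h n] absorbs the growth of [n.+1], the other makes the series converge. *)
pose c n := kappa * (h n * h n).
(* The tolerance stays summable after division by [c n], which is how it enters [bB]. *)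
pose eta n := c n * t ^+ 2 * h n.
have c0 n : 0 < c n := mulr_gt0 k0 (mulr_gt0 (h0 n) (h0 n)).
have eta0 n : 0 < eta n := mulr_gt0 (mulr_gt0 (c0 n) (exprn_gt0 2 t0)) (h0 n).
have etaS n : eta n.+1 <= eta n.
  have cS : c n.+1 <= c n.
    apply: ler_wpM2l; first exact: ltW.
    by apply: ler_pM (hS n) (hS n); exact: ltW.
  apply: ler_pM (hS n); [|exact: ltW|].
    exact: ltW (mulr_gt0 (c0 _) (exprn_gt0 2 t0)).
  by apply: ler_wpM2r cS; exact: ltW (exprn_gt0 2 t0).
have eta_d n : eta n <= d * h n.
  have -> : eta n = kappa * t ^+ 2 * (h n * h n) * h n by rewrite /eta /c; ring.
  apply: ler_wpM2r; first exact: ltW.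
  have hh : h n * h n <= 1 by rewrite mulr_ile1// ltW.
  by have := ler_wpM2l (ltW kt0) hh; rewrite /d; move: kt0; lra.
have [T [W [f [x [rho [T0E W0 WS TS P]]]]]] :=
  perturbation_sequence c hI I1 IT0 eta0.
have IT n : I (T n) by have [[]] := P n.
have opT n : is_op (T n) := hI.1 _ (IT n).
have opf n : is_op (f n) by have [[]] := P n.
have f1 n y : nr (f n y) <= nr y by have [[_ _ + _] _] := P n; apply.
have x1 n : nr (x n) <= 1 by have [[_ _ _ +] _] := P n.
have fW n : f n (W n) = emb (nr (f n (W n))) by have [_ []] := P n.
have rhoT n : opnorm re (T n) - eta n <= rho n by have [_ []] := P n.
have fT n : f n (T n (x n)) = emb (rho n) by have [_ []] := P n.
have diffT n z : nr (T n.+1 z - T n z) <=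
    c n * (opnorm re (T n) * nr z) * nr (W n.+1).
  rewrite TS addrAC subrr add0r nrZ nrM nr_emb (gtr0_norm (c0 n)).
  apply: ler_wpM2r; first exact: nr_ge0.
  apply: ler_wpM2l; first exact: ltW.
  exact: le_trans (f1 _ _) (opnorm_ub _ (opT n)).
have opT0 := hI.1 _ IT0.
have normT n : (forall z, nr (T n z - T0 z) <= 2 * d * (1 - h n) * nr z) ->
    t / 2 <= opnorm re (T n) <= 2 * t.
  move=> H; have H' : opnorm re (fun z => T n z - T0 z) <= 2 * d.
    apply: opnorm_le_bound => [|z]; first by rewrite mulr_ge0// ltW.
    apply: le_trans (H z) _; rewrite ler_wpM2r ?nr_ge0//.
    by rewrite ler_piMr ?mulr_ge0 ?gerBl ?(ltW (h0 _))// ltW.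
  have := opnormB_le (opT n) opT0; have := opnormB_le opT0 (opT n).
  by rewrite opnormBC -/t; lra.
(* Closeness of [T n] to [T0] and linear growth of [W n] go through one induction: the first bounds
   the new vector, the second helps to bound the next perturbation. *)
have inv n : (forall z, nr (T n z - T0 z) <= 2 * d * (1 - h n) * nr z) /\
    nr (W n) <= n%:R * (2 * t) ->
    nr (W n.+1) <= n.+1%:R * (2 * t) /\
    forall z, nr (T n.+1 z - T n z) <= d * h n * nr z.
  move=> [/normT/andP[_ Tn] Wn].
  have WS' : nr (W n.+1) <= n.+1%:R * (2 * t).
    rewrite WS (le_trans (nrD _ _))// -[n.+1]addn1 natrD mulrDl mul1r lerD//.
    exact: le_trans (opnorm_ball (opT n) (x1 n)) Tn.
  split=> // z; apply: le_trans (diffT n z) _.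
  apply: (@le_trans _ _ (c n * (2 * t * nr z) * (n.+1%:R * (2 * t)))).
    apply: ler_pM WS'; [|exact: nr_ge0|].
      apply: mulr_ge0 (ltW (c0 n)) _; apply: mulr_ge0 (nr_ge0 z).
      exact: opnorm_ge0.
    apply: ler_wpM2l; first exact: ltW (c0 n).
    by apply: ler_wpM2r Tn; exact: nr_ge0.
  have -> : c n * (2 * t * nr z) * (n.+1%:R * (2 * t)) =
      (d * h n * nr z) * (n.+1%:R * h n) by rewrite /c /d; ring.
  apply: ler_piMr (hn n); apply: mulr_ge0 (nr_ge0 z).
  exact: ltW (mulr_gt0 d0 (h0 n)).
have inv' n : (forall z, nr (T n z - T0 z) <= 2 * d * (1 - h n) * nr z) /\
    nr (W n) <= n%:R * (2 * t).
  elim: n => [|n IH].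
    rewrite W0 nr0 mul0r; split=> // z.
    by rewrite T0E subrr nr0 hZ subrr mulr0 mul0r.
  have [WS' dT] := inv n IH; split=> // z.
  rewrite -(subrK (T n z) (T n.+1 z)) -addrA (le_trans (nrD _ _))//.
  have := dT z; have := IH.1 z; rewrite hE; lra.
have dT n z : nr (T n.+1 z - T n z) <= d * h n * nr z by have [_] := inv n (inv' n).
have WB n : nr (W n.+1) <= n.+1%:R * (2 * t) by have [] := inv n (inv' n).
have nT n : t / 2 <= opnorm re (T n) <= 2 * t := normT n (inv' n).1.
(* [B n] is the value of [f n] on the sum that includes its own vector [T n (x n)]; [b n.+1] is the
   modulus of the value of [f n.+1] on that same sum. *)
pose b n := nr (f n (W n)); pose B n := b n + rho n.
have fB n : f n (W n.+1) = emb (B n).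
  by rewrite WS (opD _ _ (opf n)) fT (fW n) -(embD hK).
have eta_t n : eta n <= t / 4.
  have := eta_d n; have := ler_wpM2l (ltW d0) (h1 n); move: d_t; lra.
have B0 n : 0 <= B n.
  have /andP[+ _] := nT n; have := eta_t n; have := rhoT n.
  by have := nr_ge0 (f n (W n)); rewrite /B /b; move: t0; lra.
have BW n : B n <= nr (W n.+1).
  by have := f1 n (W n.+1); rewrite fB nr_emb ger0_norm.
have cB n : c n * B n <= 1.
  apply: (@le_trans _ _ (c n * (n.+1%:R * (2 * t)))).
    by apply: ler_wpM2l (le_trans (BW n) (WB n)); exact: ltW.
  have -> : c n * (n.+1%:R * (2 * t)) = 2 * (kappa * t) * (h n * (n.+1%:R * h n)).
    by rewrite /c; ring.
  have hh : h n * (n.+1%:R * h n) <= 1 by rewrite mulr_ile1// ?mulr_ge0// ltW.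
  by have := ler_wpM2l (ltW (mulr_gt0 k0 t0)) hh; move: kt; lra.
have bB n : B n - 6 * t * h n <= b n.+1.
  have [/andP[Tn _]] := nT n => //.
  have [g1 g2] := perturbation_step (TS n) (opT n) (opf n) (f1 n) (x1 n) (fT n)
    (rhoT n) (fB n) (B0 n) (ltW (c0 n)) (opf n.+1) (f1 n.+1) (x1 n.+1)
    (opT n.+1).
  rewrite fT re_emb in g2.
  apply: (perturbation_gain (c := c n) (eta := eta n) (eta1 := eta n.+1)
    t0 (c0 n) Tn (B0 n) (cB n) (ltW (h0 n)) erefl (etaS n) g1).
  exact: le_trans (rhoT n.+1) g2.
have [S opS ST] := fast_cauchy_op opT dT.
have IS : I S.
  apply: hI.2.2.2.2 => // e e0; have [n hne] := geometric_small (2 * d) e0.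
  exists (T n); split=> //; apply: le_lt_trans hne.
  apply: opnorm_le_bound (ST n); apply: mulr_ge0 (ltW (h0 n)).
  by apply: mulr_ge0 => //; exact: ltW.
have normST n : opnorm re (fun z => S z - T n z) <= 2 * d * h n.
  apply: opnorm_le_bound (ST n); apply: mulr_ge0 (ltW (h0 n)).
  by apply: mulr_ge0 => //; exact: ltW.
exists S, x; split=> //.
- rewrite opnormBC -T0E; apply: le_trans (normST 0%N) _.
  by rewrite hZ; move: d_eps d0; lra.
- have := opnormB_le opT0 opS; rewrite opnormBC -T0E -/t.
  have := normST 0%N; rewrite hZ T0E -/t; move: d_t d0 t0; lra.
(* Per step, at most [6 * t * h n] is lost in passing from [B n] to [b n.+1], [d * h n.+1] to the
   tolerance, and [2 * d * h n.+1] in replacing the norm of [T n.+1] by that of [S]. *)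
- pose a n := B n - n.+1%:R * opnorm re S.
  have aS n : a n - (6 * t + 3 * d) * h n <= a n.+1.
    have := opnormB_le opS (opT n.+1); have := normST n.+1; have := bB n.
    have := rhoT n.+1; have := eta_d n.+1; have := hS n => s1 s2 s3 s4 s5 s6.
    have := ler_wpM2l (ltW d0) s1 => s7.
    have nS : n.+2%:R = n.+1%:R + 1 :> R by rewrite -[n.+2]addn1 natrD.
    by rewrite /a nS /B -/(b n.+1); rewrite /B in s4; lra.
  have C0 : 0 <= 6 * t + 3 * d by move: t0 d0; lra.
  have aC := ge_geometric aS C0.
  (* [W n] sums the vectors [T k (x k)]; replacing [T k] by [S] costs at most [2 * d * h k] each,
     hence at most [4 * d] in all. *)
  have sumS n : nr (W n - \sum_(k < n) S (x k)) <= 4 * d * (1 - h n).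
    elim: n => [|n IH].
      by rewrite W0 big_ord0 subrr nr0 hZ subrr mulr0.
    rewrite WS big_ord_recr/= opprD addrACA (le_trans (nrD _ _))//.
    have st1 : nr (T n (x n) - S (x n)) <= 2 * d * h n.
      rewrite nrBC (le_trans (ST n (x n)))// ler_piMr// mulr_ge0 ?(ltW (h0 n))//.
      by move: d0; lra.
    by rewrite hE; lra.
  exists (Num.max 0 (4 * d + 2 * (6 * t + 3 * d) - a 0%N)) => -[|n].
    by rewrite big_ord0 nr0 mul0r subr0 le_max lexx.
  rewrite le_max; apply/orP; right.
  have := aC n; rewrite {2}/a; have := BW n; have := sumS n.+1.
  have := nrD (W n.+1 - \sum_(k < n.+1) S (x k)) (\sum_(k < n.+1) S (x k)).
  by rewrite subrK; have := mulr_gt0 d0 (h0 n.+1); lra.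
Qed.

(** The vectors [S (x k)] divided by the norm of [S] form an almost aligned sequence. If the
    resulting [e] had real part at most [opnorm re S - delta] on all [S (x k)], summing [n] terms
    would give [n * delta <= C] for every [n]. *)
Lemma extreme_norming_perturbation (I : set (X -> Y)) T0 (eps : R) :
  closed_op_subspace re I -> contains_rank_one I -> I T0 ->
  0 < opnorm re T0 -> 0 < eps ->
  exists S, [/\ I S, opnorm re (fun z => T0 z - S z) <= eps,
    0 < opnorm re S & exists2 e : Y -> K^o, dual_extreme re e &
      forall delta, 0 < delta ->
        exists2 x, nr x <= 1 & opnorm re S - delta < re (e (S x))].
Proof.
move=> hI I1 IT0 T0_gt0 eps0.
have [S [x [IS TS s0 x1 [C hC]]]] :=
  almost_aligned_perturbation hI I1 IT0 T0_gt0 eps0.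
have opS := hI.1 _ IS; exists S; split=> //; set s := opnorm re S in s0 hC *.
have uE n : \sum_(k < n) (emb s^-1 *: S (x k)) = emb s^-1 *: \sum_(k < n) S (x k).
  by rewrite scaler_sumr.
have s1 : 0 <= s^-1 by rewrite invr_ge0 ltW.
have [n|n|e he eC] :=
    @aligned_extreme_functional Y (fun k => emb s^-1 *: S (x k)) (C / s).
- rewrite nrZ nr_emb ger0_norm// ler_pdivrMl// mulr1.
  exact: opnorm_ball (x1 n).
- rewrite uE nrZ nr_emb ger0_norm// ler_pdivlMr// mulrBl mulrAC mulVf ?gt_eqF//.
  by rewrite mul1r.
exists e => // delta delta0; apply: contrapT => H.
have small k : re (e (S (x k))) <= s - delta.
  by rewrite leNgt; apply/negP => h; apply: H; exists (x k).
pose n := Num.bound (`|C| / delta).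
have hn : `|C| / delta < n%:R by rewrite archi_boundP// divr_ge0// ltW.
have sum_le : re (e (\sum_(k < n) S (x k))) <= n%:R * (s - delta).
  elim: (n) => [|k IH]; first by rewrite big_ord0 (op0 he.1) re0 mul0r.
  rewrite big_ord_recr/= (opD _ _ he.1) (reD hK) -[k.+1]addn1 natrD mulrDl mul1r.
  exact: lerD.
have := eC n; rewrite uE (opZ _ _ he.1) (re_embM hK) ler_pdivlMr//.
rewrite mulrBl mulrAC mulVf ?gt_eqF// mul1r => h1.
move: hn; rewrite ltr_pdivrMr// => h2; have := ler_norm C; lra.
Qed.

(** Both norms agree. Along a sequence on which [T] tends to its norm, [nr (T (u n))] eventually
    exceeds [M], so [nr (f (u n))] dominates it and tends to the norm of [f]; rotating each [u n]
    makes [f] nonnegative there, and strong exposition applies. *)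
Lemma strongly_exposed_ASE T (f : X -> K^o) (M : R) : is_op T -> SE re f ->
  M < opnorm re f ->
  (forall x, nr x <= 1 -> nr (f x) <= nr (T x) <= Num.max (nr (f x)) M) ->
  ASE re T.
Proof.
move=> opT [opf [x0 [/ball1P x01 [x0max x0exp]]]] Mf fT; split=> //.
have fx0 : re (f x0) = opnorm re f.
  apply/eqP; rewrite eq_le; apply/andP; split.
    exact: le_trans (re_le_nr _) (opnorm_ball opf x01).
  apply: opnorm_le => x x1; have [t [t1 ht]] := rotate (f x).
  rewrite -[leLHS]re_emb -ht -[t * f x](opZ t x opf); apply: x0max.
  by apply/ball1P; rewrite nrZ nr_unit// mul1r.
have TfE : opnorm re T = opnorm re f.
  apply/eqP; rewrite eq_le; apply/andP; split; apply: opnorm_le => x x1.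
    have /andP[_ /le_trans] := fT x x1; apply.
    by rewrite ge_max opnorm_ball// ltW.
  by have /andP[h _] := fT x x1; exact: le_trans h (opnorm_ball opT x1).
exists x0; split=> [|u u1 Tu]; first exact/ball1P.
have /choice[th hth] : forall n, exists t : K, `|t| = 1 /\
    t * f (u n) = emb (nr (f (u n))) by move=> n; exact: rotate.
exists th; split=> [n|]; first by case: (hth n).
apply: x0exp => [n|].
  apply/ball1P; rewrite nrZ nr_unit ?mul1r; first exact/ball1P.
  by case: (hth n).
have fuE n : re (f (th n *: u n)) = nr (f (u n)).
  by rewrite (opZ _ _ opf) [th n *: f (u n)](hth n).2 re_emb.
under eq_fun do rewrite fuE; rewrite fx0; apply/cvgrPdist_lt => e e0.
move/cvgrPdist_lt in Tu; rewrite TfE in Tu.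
have d0 : 0 < Num.min e (opnorm re f - M) by rewrite lt_min e0 subr_gt0.
near=> n.
have un1 : nr (u n) <= 1 by apply/ball1P.
have fu : nr (f (u n)) <= opnorm re f := opnorm_ball opf un1.
have : `|opnorm re f - nr (T (u n))| < Num.min e (opnorm re f - M).
  by near: n; exact: Tu.
rewrite lt_min ltr_norml => /andP[/andP[_ h1]]; rewrite ltr_norml => /andP[_ h2].
have /andP[_] := fT _ un1; rewrite le_max => /orP[h3|h3]; last by lra.
by rewrite ger0_norm ?subr_ge0//; lra.
Unshelve. all: by end_near. Qed.

End Perturbation.

(** * Property quasi-beta and the density of absolutely strongly exposing operators *)

Lemma quasi_beta_norming (Y : normedModType K) (A : set (Y -> K^o))
    (y : Y) (M : R) :
  (forall es, dual_extreme re es -> exists Ae : set (Y -> K^o), Ae `<=` A /\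
    exists t : K, `|t| = 1 /\ weakstar_closure re Ae (fun y => t * es y)) ->
  0 <= M -> (forall a, A a -> nr (a y) <= M) -> nr y <= M.
Proof.
move=> hA M0 aM; have [y0|y0] := eqVneq (nr y) 0; first by rewrite y0.
have y0' : 0 < nr y by rewrite lt_neqAle eq_sym y0 nr_ge0.
have [|e he ey] := @extreme_functional_norming Y (emb (nr y)^-1 *: y).
  by rewrite nrZ nr_emb ger0_norm ?invr_ge0 ?nr_ge0// mulVf.
rewrite (opZ _ _ he.1) (re_embM hK) in ey.
have {}ey : re (e y) = nr y by rewrite -[LHS](mulVKf y0) ey mulr1.
have [Ae [AeA [t [t1 tcl]]]] := hA e he.
(* Testing the weak-star closure at the single vector [y] gives [a] with [nr (a y)] within [d] of
   [nr (e y)], which is at least [nr y]. *)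
apply/ler_addgt0Pr => d d0; have [a [Aa ha]] := tcl [:: y] d d0.
have := ha y; rewrite mem_head => /(_ isT) h.
have := aM a (AeA a Aa); have := nrB (a y) (a y - t * e y).
rewrite opprB addrC subrK nrM (nr_unit t1) mul1r => h1 h2.
by have := re_le_nr (e y); lra.
Qed.

(** The error is split into [e / 4] for making the operator nonzero, [e / 4] for gaining an almost
    attaining extreme functional, and [delta + kappa] for the last rank one correction. *)
Lemma quasi_beta_ASE_dense (X Y : completeNormedModType K) (I : set (X -> Y)) :
  op_dense re (@SE R K re X) (@is_op K X K^o) -> quasi_beta re Y ->
  closed_op_subspace re I -> contains_rank_one I ->
  op_dense re (@ASE R K re X Y) I.
Proof.
move=> SEd [A [sigma [rho [Aop [sig1 [Asig [Arho Aext]]]]]]] hI I1 T IT e e0.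
have opI S : I S -> is_op S by move=> IS; exact: hI.1.
(* On the trivial space every operator belongs to [ASE], with limit point 0. *)
have [[x0 hx0]|X0] := pselect (exists x : X, nr x != 0); last first.
  exists T; split; last first.
    split=> //; have -> : (fun x => T x - T x) = fun=> 0.
      by apply/funext => x; rewrite subrr.
    by apply: le_lt_trans e0; apply: opnorm_le => x _; rewrite nr0.
  split; [exact: opI|exists 0; split=> [|u _ _]].
    by apply/ball1P; rewrite nr0.
  have all0 (x : X) : x = 0.
    apply: nr_eq0; apply/eqP; apply: contrapT => /negP h; apply: X0; by exists x.
  exists (fun=> 1); split=> [_|]; first by rewrite normr1.
  under eq_fun do rewrite (all0 (_ *: _)); exact: cvg_cst.
have Aext' es : dual_extreme re es -> exists Ae : set (Y -> K^o), Ae `<=` A /\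
    exists t : K, `|t| = 1 /\ weakstar_closure re Ae (fun y => t * es y).
  by move=> /Aext[Ae [AeA [t [t1 [tcl _]]]]]; exists Ae; split=> //; exists t.
(* A zero [T] is first replaced by a rank one operator of norm [e / 4]. *)
have [T1 [IT1 TT1 T1_gt0]] : exists T1, [/\ I T1,
    opnorm re (fun x => T x - T1 x) <= e / 4 & 0 < opnorm re T1].
  have T0 := opnorm_ge0 (opI T IT).
  have [T_gt0|T_le0] := ltP 0 (opnorm re T).
    exists T; split=> //; have -> : (fun x => T x - T x) = fun=> 0.
      by apply/funext => x; rewrite subrr.
    by apply: opnorm_le => x _; rewrite nr0 divr_ge0// ltW.
  have Tz x : T x = 0.
    apply: nr_eq0; apply/eqP; rewrite eq_le nr_ge0 andbT.
    apply: le_trans (opnorm_ub x (opI T IT)) _.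
    by rewrite mulr_le0_ge0// nr_ge0.
  have [es hes] := dual_extreme_exists Y.
  have [Ae [AeA [? [_ [cl _]]]]] := Aext es hes.
  (* An empty list of test vectors just picks an element of [A], hence a unit vector [sigma a]. *)
  have [a [/AeA Aa _]] := cl [::] 1 ltr01.
  have sa : nr (sigma a) = 1 by rewrite sig1// -(emb1 hK) re_emb.
  have x00 : 0 < nr x0 by rewrite lt_neqAle eq_sym hx0 nr_ge0.
  have nx1 : nr (emb (nr x0)^-1 *: x0) = 1.
    by rewrite nrZ nr_emb ger0_norm ?invr_ge0 ?nr_ge0// mulVf.
  have [f [opf [f1 _]] fx] := extreme_functional_norming nx1.
  have opF : is_op (fun x => f x *: sigma a) := is_op_rank_one (sigma a) opf.
  exists (fun x => emb (e / 4) *: (f x *: sigma a)); split.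
  - by apply: hI.2.2.2.1; exact: I1.
  - apply: opnorm_le => x x1; rewrite Tz sub0r nrN !nrZ nr_emb sa mulr1.
    rewrite ger0_norm ?divr_ge0 ?(ltW e0)// ler_piMr ?divr_ge0 ?(ltW e0)//.
    exact: le_trans (opnorm_ball opf x1) f1.
  - have e4 : 0 < e / 4 by rewrite divr_gt0.
    apply: (lt_le_trans e4).
    have := opnorm_ball (is_op_scale (emb (e / 4)) opF)
      (eq_ind_r (fun r => r <= 1) (lexx _) nx1).
    apply: le_trans; rewrite !nrZ nr_emb sa mulr1 (gtr0_norm e4).
    by rewrite ler_peMr ?(ltW e4)// -fx re_le_nr.
have e4 : 0 < e / 4 by rewrite divr_gt0.
have [S [IS T1S s0 [es hes Ses]]] :=
  extreme_norming_perturbation hI I1 IT1 T1_gt0 e4.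
have opS := opI S IS; set s := opnorm re S in s0 Ses.
have [Ae [AeA [t [t1 [tcl [r0 [r0lt1 rhor0]]]]]]] := Aext es hes.
pose r := Num.max r0 0.
have r1 : r < 1 by rewrite gt_max r0lt1 ltr01.
have r_ge0 : 0 <= r by rewrite le_max lexx orbT.
have rhor a : Ae a -> rho a <= r by move=> /rhor0 h; rewrite le_max h.
pose kappa := e / 8; have k0 : 0 < kappa by rewrite divr_gt0.
(* Scaling by [q] lifts the norm of [a o S] to nearly [s + kappa], which makes room above [M]. *)
pose q := 1 + kappa / s.
have q1 : 1 <= q by rewrite lerDl divr_ge0// ltW.
have q0 : 0 < q by apply: lt_le_trans q1.
have qs : q * s = s + kappa by rewrite mulrDl mul1r divfK// gt_eqF.
(* Chosen for [nuM]: the norm of [f] exceeds [s + kappa - 3 * delta], while [M] is at most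
   [s + kappa - 7 * delta]. *)
pose delta := (1 - r) * kappa / 8.
have d0 : 0 < delta by rewrite divr_gt0// mulr_gt0// subr_gt0.
have dk : delta <= kappa / 8.
  by rewrite ler_pM2r ?invr_gt0// ler_piMl ?(ltW k0)// gerBl.
have [x x1 hx] := Ses (delta / q) (divr_gt0 d0 q0).
have [a [Aea ha]] := tcl [:: S x] (delta / q) (divr_gt0 d0 q0).
have Aa := AeA a Aea; have [opa na] := Aop a Aa.
have {}ha := ha (S x) (mem_head _ _).
have sa : nr (sigma a) = 1 by rewrite sig1// -(emb1 hK) re_emb.
have aSx : s - 2 * (delta / q) < nr (a (S x)).
  have := nrB (a (S x)) (a (S x) - t * es (S x)).
  rewrite opprB addrC subrK nrM (nr_unit t1) mul1r => h1.
  by have := re_le_nr (es (S x)); lra.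
have a1 y : nr (a y) <= nr y.
  by apply: le_trans (opnorm_ub y opa) _; rewrite na mul1r.
have opg : @is_op K X K^o (fun z => a (S z)) := is_op_comp opa opS.
have opqg := is_op_scale (emb q) opg.
have gz z : nr z <= 1 -> nr (a (S z)) <= s.
  by move=> z1; apply: le_trans (a1 _) (opnorm_ball opS z1).
have [f [SEf [opf fd]]] := SEd _ opqg delta d0.
have opqf := is_op_sub opqg opf.
have fq z : nr z <= 1 -> nr (emb q * a (S z) - f z) <= delta.
  by move=> z1; apply: le_trans (opnorm_ball opqf z1) (ltW fd).
have fg z : nr z <= 1 -> nr (f z - a (S z)) <= delta + kappa.
  move=> z1; have -> : f z - a (S z) =
      emb (q - 1) * a (S z) - (emb q * a (S z) - f z).
    by rewrite (embD hK) embN (emb1 hK); ring.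
  apply: le_trans (nrB _ _) _; rewrite addrC; apply: lerD (fq z z1) _.
  have q1' : 0 <= q - 1 by rewrite subr_ge0.
  rewrite nrM nr_emb (ger0_norm q1').
  by have := ler_wpM2l q1' (gz z z1); move: qs; lra.
pose F z := S z + (f z - a (S z)) *: sigma a.
have opfg : @is_op K X K^o (fun z => f z - a (S z)) := is_op_sub opf opg.
have IF : I F := closed_subspace_rank_one_perturbation (sigma a) hI I1 IS opfg.
have opF := opI F IF.
have aF z : a (F z) = f z.
  by rewrite /F (opD _ _ opa) (opZ _ _ opa) Asig// /GRing.scale/= mulr1 addrC subrK.
(* This bounds [nr (b (F z))] on the unit ball for the other [b] in [A], as
   [nr (b (sigma a)) <= rho a <= r]. *)
pose M := s + r * (delta + kappa).
have nuM : M < opnorm re f.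
  have h1 : nr (emb q * a (S x)) <= nr (f x) + delta.
    have := nrD (f x) (emb q * a (S x) - f x); rewrite addrC subrK => /le_trans.
    by apply; rewrite lerD2l; exact: fq.
  rewrite nrM nr_emb (gtr0_norm q0) in h1.
  have h2 := opnorm_ball opf x1.
  have h3 : q * (s - 2 * (delta / q)) < q * nr (a (S x)) by rewrite ltr_pM2l.
  have h4 : q * (s - 2 * (delta / q)) = s + kappa - 2 * delta.
    by rewrite mulrBr qs; congr (_ - _); rewrite mulrCA [q * _]mulrC divfK// gt_eqF.
  have h5 : r * delta <= delta by rewrite ler_piMl// ltW.
  have h6 : kappa - r * kappa = 8 * delta by rewrite /delta; field.
  by rewrite /M mulrDr; lra.
have M0 : 0 <= M by rewrite addr_ge0 ?mulr_ge0 ?addr_ge0// ltW.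
exists F; split; last split=> //.
  apply: (strongly_exposed_ASE opF SEf nuM) => z z1; apply/andP; split.
    by rewrite -aF; exact: a1.
  apply: (quasi_beta_norming Aext') => [|b Ab]; first by rewrite le_max M0 orbT.
  rewrite le_max; have [->|ba] := pselect (b = a); first by rewrite aF lexx.
  apply/orP; right; have [opb nb] := Aop b Ab.
  have ab : a <> b by move=> h; apply: ba.
  have [rb _] := Arho a b Aa Ab ab.
  rewrite /F (opD _ _ opb) (opZ _ _ opb); apply: le_trans (nrD _ _) _.
  apply: lerD.
    apply: le_trans (opnorm_ub _ opb) _; rewrite nb mul1r.
    exact: opnorm_ball opS z1.
  rewrite nrZ mulrC; apply: ler_pM (nr_ge0 _) (nr_ge0 _) _ (fg z z1).
  exact: le_trans rb (rhor a Aea).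
apply: (@le_lt_trans _ _ (e / 4 + e / 4 + (delta + kappa))); last first.
  by move: dk k0; rewrite /kappa; lra.
apply: opnorm_le => z z1.
have -> : T z - F z = (T z - T1 z) + (T1 z - S z) - (f z - a (S z)) *: sigma a.
  by rewrite /F opprD addrA; congr (_ - _); rewrite subrKA.
apply: le_trans (nrB _ _) _; apply: lerD.
  apply: le_trans (nrD _ _) _; apply: lerD.
    exact: le_trans (opnorm_ball (is_op_sub (opI T IT) (opI T1 IT1)) z1) TT1.
  exact: le_trans (opnorm_ball (is_op_sub (opI T1 IT1) opS) z1) T1S.
by rewrite nrZ sa mulr1; exact: fg.
Qed.

(** * Compact operators as a closed subspace containing the rank one operators *)

Section CompactOperators.

Definition totally_bounded (V : normedModType K) (B : set V) :=
  forall e : R, 0 < e ->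
    exists s : seq V, forall v, B v -> exists2 w, w \in s & nr (v - w) < e.

Lemma compact_closure_totally_bounded (V : normedModType K) (B : set V) :
  compact (closure B) -> totally_bounded B.
Proof.
rewrite compact_cover => cB e e0.
have e0' : 0 < emb e by rewrite -emb0 emb_lt.
have [|v clv|D _ hD] := cB V setT (fun w => ball w (emb e)).
- by move=> w _; exact: ball_open.
- by exists v => //; exact: ballxx.
exists (finmap.enum_fset D) => v /subset_closure /hD [w /= wD].
by rewrite -ball_normE/= norm_lt nrBC => h; exists w.
Qed.

(** An ultrafilter on the closure that missed every ball of radius [e] would contain the complement
    of finitely many of them that cover the closure. Hence it is Cauchy, and completeness gives its
    limit. *)
Lemma totally_bounded_compact_closure (V : completeNormedModType K) (B : set V) :
  totally_bounded B -> compact (closure B).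
Proof.
move=> tB; rewrite compact_ultra => F UF FB.
have small e : 0 < e -> exists w, F (ball w e).
  move=> e0; have ee := ge0_emb hK (ltW e0).
  have e0' : 0 < re e by rewrite -emb_lt -ee emb0.
  have [|s hs] := tB (re e / 2); first by rewrite divr_gt0.
  apply: contrapT => /forallNP nF.
  have FC : F [set v | forall w, w \in s -> ~ ball w e v].
    elim: (s) => [|w s' IH]; first exact: filterS filterT.
    have [/nF//|Fw] := in_ultra_setVsetC (ball w e) UF.
    apply: filterS (filterI Fw IH) => v [vw vs] z.
    by rewrite inE => /orP[/eqP->|]; [exact: vw|exact: vs].
  have [v [vB vC]] := filter_ex (filterI FB FC).
  have [|v' [Bv' vv']] := vB (ball v (emb (re e / 2))).
    by apply: nbhsx_ballx; rewrite -emb0 emb_lt divr_gt0.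
  have [w ws hw] := hs v' Bv'; apply: (vC w ws).
  move: vv'; rewrite -!ball_normE/= norm_lt ee norm_lt => h.
  rewrite -(subrK v' w) -addrA (le_lt_trans (nrD _ _))// [ltRHS]splitr.
  by rewrite re_emb in h; rewrite ltrD// nrBC.
have : cauchy F by exact: cauchy_exP.
move=> /cauchy_cvgP/cvg_ex[l Fl]; exists l; split=> //.
apply: (closed_closure (A := B)) => U /Fl FU.
by have [v [? ?]] := filter_ex (filterI FB FU); exists v.
Qed.

Lemma compact_opP (X : normedModType K) (Y : completeNormedModType K) (T : X -> Y) :
  compact_op T <-> is_op T /\ totally_bounded (T @` @ball1 K X).
Proof.
split=> -[opT cT]; split=> //; first exact: compact_closure_totally_bounded.
exact: totally_bounded_compact_closure.
Qed.

Variables (X : normedModType K) (Y : completeNormedModType K).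

Lemma closed_op_subspace_is_op : closed_op_subspace re (@is_op K X Y).
Proof.
split=> //; split; first exact: is_op0.
split; first by move=> T S; exact: is_op_add.
by split=> // a T; exact: is_op_scale.
Qed.

Lemma compact_op_rank_one : contains_rank_one (@compact_op K X Y).
Proof.
move=> f y opf; apply/compact_opP; split=> [|e e0]; first exact: is_op_rank_one.
have y1 : 0 < nr y + 1 by rewrite ltr_wpDl ?nr_ge0.
have [s hs] := disc_totally_bounded hK (opnorm re f) (divr_gt0 e0 y1).
exists [seq w *: y | w <- s] => _ [x /ball1P x1 <-].
have [w ws hw] := hs (f x) (opnorm_ball opf x1).
exists (w *: y); first exact: map_f.
rewrite -scalerBl nrZ; move: hw; rewrite ltr_pdivlMr//; apply: le_lt_trans.
by rewrite ler_wpM2l ?(re_ge0 hK)// lerDl.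
Qed.

Lemma closed_op_subspace_compact_op : closed_op_subspace re (@compact_op K X Y).
Proof.
split; first by move=> T [].
split.
  apply/compact_opP; split=> [|e e0]; first exact: is_op0.
  exists [:: 0] => _ [x _ <-]; exists 0; first exact: mem_head.
  by rewrite subrr nr0.
split.
  move=> T S /compact_opP[opT cT] /compact_opP[opS cS]; apply/compact_opP.
  split=> [|e e0]; first exact: is_op_add.
  have e2 : 0 < e / 2 by rewrite divr_gt0.
  have [s hs] := cT _ e2; have [s' hs'] := cS _ e2.
  exists [seq v + w | v <- s, w <- s'] => _ [x x1 <-].
  have [v vs hv] := hs (T x) (imageP T x1).
  have [w ws hw] := hs' (S x) (imageP S x1).
  exists (v + w); first by apply/allpairsP; exists (v, w).
  rewrite opprD addrACA (le_lt_trans (nrD _ _))// [ltRHS]splitr.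
  by rewrite ltrD.
split.
  move=> a T /compact_opP[opT cT]; apply/compact_opP.
  split=> [|e e0]; first exact: is_op_scale.
  have a1 : 0 < nr a + 1 by rewrite ltr_wpDl ?(re_ge0 hK).
  have [s hs] := cT _ (divr_gt0 e0 a1).
  exists [seq a *: w | w <- s] => _ [x x1 <-].
  have [w ws hw] := hs (T x) (imageP T x1).
  exists (a *: w); first exact: map_f.
  rewrite -scalerBr nrZ mulrC; move: hw; rewrite ltr_pdivlMr//.
  by apply: le_lt_trans; rewrite ler_wpM2l ?nr_ge0// lerDl.
(* A net at [e / 2] for the image under a nearby [S] is a net at [e] for the image under [T]. *)
move=> T opT Tapp; apply/compact_opP; split=> // e e0.
have e2 : 0 < e / 2 by rewrite divr_gt0.
have [S [/compact_opP[opS cS] TS]] := Tapp _ e2.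
have [s hs] := cS _ e2; exists s => _ [x x1 <-].
have [w ws hw] := hs (S x) (imageP S x1); exists w => //.
rewrite -(subrK (S x) (T x)) -addrA (le_lt_trans (nrD _ _))// [ltRHS]splitr.
rewrite ltrD//; apply: le_lt_trans TS.
by apply: (opnorm_ball (is_op_sub opT opS)); exact/ball1P.
Qed.

End CompactOperators.

Lemma quasi_beta_theorem : theorem3p1_claim re.
Proof.
move=> X Y SEd qY; split; first by move=> I; exact: quasi_beta_ASE_dense.
split; apply: quasi_beta_ASE_dense => //.
- exact: closed_op_subspace_is_op.
- by move=> f y; exact: is_op_rank_one.
- exact: closed_op_subspace_compact_op.
- exact: compact_op_rank_one.
Qed.

End Scalars.

(** * The real and the complex field as instances of [real_part] *)

Lemma interval_net (R : realType) (M e : R) : 0 < e ->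
  exists s : seq R, forall z, `|z| <= M -> exists2 w, w \in s & `|z - w| < e.
Proof.
move=> e0; pose n := Num.bound (2 * M / e).
exists [seq e * k%:R - M | k <- iota 0 n] => z zM.
have M0 : 0 <= M := le_trans (normr_ge0 z) zM.
move: zM; rewrite ler_norml => /andP[zM1 zM2].
have q0 : 0 <= (z + M) / e by rewrite divr_ge0 ?(ltW e0)//; lra.
have /andP[k1 k2] := truncn_itv q0; set k := Num.truncn _ in k1 k2.
exists (e * k%:R - M).
  apply/mapP; exists k => //; rewrite mem_iota add0n leq0n/= -(ltr_nat R).
  apply: (@le_lt_trans _ _ (2 * M / e)); last first.
    by rewrite archi_boundP// divr_ge0 ?(ltW e0)// mulr_ge0.
  by apply: le_trans k1 _; rewrite ler_pM2r ?invr_gt0//; lra.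
rewrite ler_pdivlMr// in k1; rewrite ltr_pdivrMr// -[k.+1]addn1 natrD in k2.
by rewrite ltr_norml; apply/andP; split; lra.
Qed.

Lemma real_part_id (R : realType) : @real_part R R id id.
Proof.
split=> // [z|V p pD pZ|M e e0]; first exact: ler_norm.
  by exists p; split=> // a x y; rewrite pD pZ.
exact: interval_net.
Qed.

Lemma real_part_complex (R : realType) :
  @real_part R R[i] (@complex.Re R) (real_complex R).
Proof.
split.
- by move=> [a b] [c d].
- by move=> a [b c] /=; rewrite mul0r subr0.
- by [].
- exact: rmorphD.
- exact: rmorphM.
- by move=> a a0; rewrite ler0c.
- by move=> [a b]; rewrite lecE/= => /andP[/eqP->].
- by move=> z; rewrite lecE => /andP[_].
- move=> z; have := normc_ge_Re z; rewrite lecE/= => /andP[_].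
  by apply: le_trans (ler_norm _).
- move=> V p pD pZ.
  have pN x : p (- x) = - p x.
    have := pD x (- x); have := pD 0 0; rewrite addr0 subrr; lra.
  exists (fun x => Complex (p x) (- p ('i%C *: x))); split=> // a x y.
  have aE : a = real_complex R (complex.Re a) + real_complex R (complex.Im a) * 'i%C.
    by rewrite [LHS]complexE [X in _ + X = _]mulrC.
  have pa z : p (a *: z) = complex.Re a * p z + complex.Im a * p ('i%C *: z).
    by rewrite {1}aE scalerDl pD pZ -scalerA pZ.
  have pia : p ('i%C *: (a *: x)) =
      complex.Re a * p ('i%C *: x) - complex.Im a * p x.
    rewrite scalerA mulrC -scalerA pa scalerA -expr2 sqr_i scaleN1r pN; lra.
  rewrite scalerDr !pD pia pa; case: (a) => u v /=; apply/eqP.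
  by rewrite eq_complex/=; apply/andP; split; apply/eqP; ring.
- move=> M e e0.
  (* A product of two interval nets at [e / 2] works, as the modulus is at most the sum of the
     absolute values of the real and imaginary parts. *)
  have [s hs] := interval_net M (divr_gt0 e0 (ltr0Sn R 1)).
  exists [seq Complex a b | a <- s, b <- s] => -[u v] zM.
  have [uM vM] : `|u| <= M /\ `|v| <= M.
    by split; apply: le_trans zM; rewrite normc_def/= -[leLHS]sqrtr_sqr
      ler_wsqrtr// ?lerDl ?lerDr sqr_ge0.
  have [a sa ua] := hs u uM; have [b sb vb] := hs v vM.
  exists (Complex a b); first by apply/allpairsP; exists (a, b).
  rewrite normc_def/=; apply: (@le_lt_trans _ _ (`|u - a| + `|v - b|)).
    have h : 0 <= `|u - a| + `|v - b| by rewrite addr_ge0.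
    rewrite -[leRHS](ger0_norm h) -[leRHS]sqrtr_sqr ler_wsqrtr// [leRHS]sqrrD.
    by rewrite !real_normK ?num_real// lerD2r lerDl mulrn_wge0// mulr_ge0.
  by rewrite [ltRHS]splitr ltrD.
Qed.

Theorem theorem3p1 (R : realType) :
  theorem3p1_claim (R := R) (K := R) id /\
  theorem3p1_claim (R := R) (K := R[i]) (@complex.Re R).
Proof.
split; first exact: (quasi_beta_theorem (real_part_id R)).
exact: (quasi_beta_theorem (real_part_complex R)).
Qed.
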